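(* Let $W$ be the right-angled Coxeter group associated to a finite simplicial graph $X$, let $\Sigma$ be the flag complex of $X$ and $\mathcal P$ the set of its simplices including the empty simplex. For $n\ge0$ and $k\ge0$ put $\rho_{n,k}=\sum_{j=k}^{n-1}(-1)^{n-1-j}\binom jk$. Then for all $n\ge1$ $$H_n(W;\mathbb Z)\cong\bigoplus_{\sigma\in\mathcal P}\ \bigoplus_{j=1}^{\rho_{n,\dim(\sigma)}}C_2,$$ where the empty simplex contributes the trivial group.
   Context: The right-angled Coxeter group of $X$ is the graph product over $X$ in which every vertex group is cyclic of order two: one generator of order two per vertex, with generators of adjacent vertices commuting and no further relations. The flag complex of $X$ has as non-empty simplices the non-empty sets of pairwise adjacent vertices; the empty simplex has dimension $-1$. $C_2$ is the cyclic group of order two. Convention: $\sum_{j=a}^b c_j=0$ if $a>b$. *)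

(* Defs.v *)
(* [boolp] turns the undecidable relations below into boolean ones, so that the
   quotient constructions of generic_quotient and ring_quotient apply. *)
From HB Require Import structures.
From mathcomp Require Import all_boot all_order all_algebra.
From mathcomp Require Import ring_quotient generic_quotient.
From mathcomp Require Import boolp.
From mathcomp.multinomials Require Import freeg.

Set Implicit Arguments.
Unset Strict Implicit.
Unset Printing Implicit Defensive.

Import GRing.Theory.

Local Open Scope ring_scope.
Local Open Scope quotient_scope.

(* A simplicial graph is a finite type of vertices with a symmetric,
   irreflexive adjacency relation [e]; both conditions on [e] are hypotheses
   of the theorem, so the constructions below take an arbitrary [e]. *)

Section RightAngledCoxeterGroup.
Variables (T : finType) (e : rel T).

(* The congruence on words in the vertices generated by [x x = 1] and by
   [x y = y x] for adjacent [x] and [y].  As every generator is its own inverse,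
   the quotient monoid is the group with this presentation. *)
Inductive racg_congr : seq T -> seq T -> Prop :=
| RacgRefl u : racg_congr u u
| RacgSym u v : racg_congr u v -> racg_congr v u
| RacgTrans u v w : racg_congr u v -> racg_congr v w -> racg_congr u w
| RacgSquare u v x : racg_congr (u ++ [:: x, x & v]) (u ++ v)
| RacgComm u v x y :
    e x y -> racg_congr (u ++ [:: x, y & v]) (u ++ [:: y, x & v]).

Definition racg_rel (u v : seq T) : bool := `[< racg_congr u v >].

Lemma racg_rel_is_equiv : equiv_class_of racg_rel.
Proof.
split=> [u|u v|v u w].
- by apply/asboolP; apply: RacgRefl.
- by apply/asboolP/asboolP; apply: RacgSym.
- by move=> /asboolP uv /asboolP vw; apply/asboolP; apply: RacgTrans uv vw.
Qed.

Canonical racg_rel_equiv := EquivRelPack racg_rel_is_equiv.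
Canonical racg_rel_encModRel := defaultEncModRel racg_rel.

Definition racg := {eq_quot racg_rel}.

HB.instance Definition _ : EqQuotient _ racg_rel racg := EqQuotient.on racg.
HB.instance Definition _ := Choice.on racg.

Lemma racg_congr_catl w u v : racg_congr u v -> racg_congr (w ++ u) (w ++ v).
Proof.
elim=> {u v} [u|u v _|u v z _ uv _ vz|u v x|u v x y exy].
- exact: RacgRefl.
- exact: RacgSym.
- exact: RacgTrans uv vz.
- by rewrite !catA; apply: RacgSquare.
- by rewrite !catA; apply: RacgComm.
Qed.

Lemma racg_congr_catr w u v : racg_congr u v -> racg_congr (u ++ w) (v ++ w).
Proof.
elim=> {u v} [u|u v _|u v z _ uv _ vz|u v x|u v x y exy].
- exact: RacgRefl.
- exact: RacgSym.
- exact: RacgTrans uv vz.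
- by rewrite -!catA; apply: RacgSquare.
- by rewrite -!catA; apply: RacgComm.
Qed.

Lemma racg_congr_cat u u' v v' :
  racg_congr u u' -> racg_congr v v' -> racg_congr (u ++ v) (u' ++ v').
Proof.
move=> /(racg_congr_catr v) uu' /(racg_congr_catl u'); exact: RacgTrans uu'.
Qed.

Lemma racg_congr_rev u v : racg_congr u v -> racg_congr (rev u) (rev v).
Proof.
elim=> {u v} [u|u v _|u v z _ uv _ vz|u v x|u v x y exy].
- exact: RacgRefl.
- exact: RacgSym.
- exact: RacgTrans uv vz.
- by rewrite !rev_cat !rev_cons -!cats1 -!catA; apply: RacgSquare.
- rewrite !rev_cat !rev_cons -!cats1 -!catA.
  by apply: RacgSym; apply: RacgComm.
Qed.

Lemma racg_congr_revK u : racg_congr (rev u ++ u) [::].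
Proof.
elim: u => [|x u IHu] /=; first exact: RacgRefl.
by rewrite rev_cons cat_rcons; apply: RacgTrans (RacgSquare _ _ _) IHu.
Qed.

Definition racg_one : racg := \pi_racg [::].
Definition racg_mul (g h : racg) : racg := \pi_racg (repr g ++ repr h).
Definition racg_inv (g : racg) : racg := \pi_racg (rev (repr g)).

Lemma racg_piP u v : \pi_racg u = \pi_racg v <-> racg_congr u v.
Proof.
by split=> [/eqmodP /asboolP //|uv]; apply/eqmodP/asboolP.
Qed.

Lemma racg_repr_pi u : racg_congr (repr (\pi_racg u)) u.
Proof. by apply/racg_piP; rewrite reprK. Qed.

Lemma racg_piM u v : racg_mul (\pi_racg u) (\pi_racg v) = \pi_racg (u ++ v).
Proof. by apply/racg_piP/racg_congr_cat; apply: racg_repr_pi. Qed.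

Lemma racg_piV u : racg_inv (\pi_racg u) = \pi_racg (rev u).
Proof. by apply/racg_piP/racg_congr_rev/racg_repr_pi. Qed.

Lemma racg_mulA : associative racg_mul.
Proof.
move=> g h k; apply/racg_piP.
apply: (@RacgTrans _ (repr g ++ repr h ++ repr k)).
  by apply: racg_congr_catl; apply: racg_repr_pi.
by rewrite catA; apply/racg_congr_catr/RacgSym/racg_repr_pi.
Qed.

Lemma racg_mul1 : left_id racg_one racg_mul.
Proof. by move=> g; rewrite -[g]reprK racg_piM. Qed.

Lemma racg_mulr1 : right_id racg_one racg_mul.
Proof. by move=> g; rewrite -[g]reprK racg_piM cats0. Qed.

Lemma racg_mulV : left_inverse racg_one racg_inv racg_mul.
Proof.
move=> g; rewrite -[g]reprK racg_piV racg_piM.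
by apply/racg_piP/racg_congr_revK.
Qed.

Lemma racg_mulrV : right_inverse racg_one racg_inv racg_mul.
Proof.
move=> g; rewrite -[g]reprK racg_piV racg_piM; apply/racg_piP.
by rewrite -[X in X ++ _]revK; apply: racg_congr_revK.
Qed.

HB.instance Definition _ := isGroup.Build racg
  racg_mulA racg_mul1 racg_mulr1 racg_mulV racg_mulrV.

End RightAngledCoxeterGroup.

Section GroupHomology.
Variable G : groupType.

(* The unnormalized bar complex: the degree n part of Z (x)_{ZG} (bar resolution)
   is free abelian on the symbols [g_1|...|g_n]. *)
Definition bar_chain (n : nat) := {freeg (n.-tuple G) / int}.

(* The i-th face of [g_1|...|g_(n+1)]: it drops g_1 if i = 0, drops g_(n+1) if
   i = n+1, and multiplies g_i and g_(i+1) otherwise. *)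
Definition bar_face (n : nat) (i : 'I_n.+2) (g : n.+1.-tuple G) : n.-tuple G :=
  [tuple if j.+1 < i then tnth g (widen_ord (leqnSn n) j)
         else if j.+1 == i :> nat
         then (tnth g (widen_ord (leqnSn n) j) * tnth g (fintype.lift ord0 j))%g
         else tnth g (fintype.lift ord0 j) | j < n]%N.

Definition bar_diff (n : nat) : bar_chain n -> bar_chain n.-1 :=
  if n is m.+1 then
    fglift (fun g : m.+1.-tuple G =>
      \sum_(i < m.+2) (-1) ^+ i *: (<< bar_face i g >> : bar_chain m))
  else fun _ => 0.

Arguments bar_diff n c : simpl never.

Lemma bar_diff_is_zmod_morphism n : zmod_morphism (@bar_diff n).
Proof.
by case: n => [|m] c d; rewrite /bar_diff ?subr0 //; exact: lift_is_additive.
Qed.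

HB.instance Definition _ n := GRing.isZmodMorphism.Build
  (bar_chain n) (bar_chain n.-1) (@bar_diff n) (bar_diff_is_zmod_morphism (n:=n)).

Definition bar_cycle (n : nat) : {pred bar_chain n} :=
  [pred c | bar_diff c == 0].

Lemma bar_cycle_closed n : zmod_closed (@bar_cycle n).
Proof.
split=> [|c d]; rewrite !inE ?raddf0 // => /eqP c0 /eqP d0.
by rewrite raddfB /= c0 d0 subr0.
Qed.

HB.instance Definition _ n := GRing.isZmodClosed.Build
  (bar_chain n) (@bar_cycle n) (@bar_cycle_closed n).

Record cycles (n : nat) :=
  Cycle { cycle_val :> bar_chain n; _ : cycle_val \in @bar_cycle n }.

HB.instance Definition _ n := [isSub for @cycle_val n].
HB.instance Definition _ n := [Choice of cycles n by <:].
HB.instance Definition _ n := [SubChoice_isSubZmodule of cycles n by <:].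

Definition boundaries (n : nat) : {pred cycles n} :=
  [pred z : cycles n | `[< exists c : bar_chain n.+1, bar_diff c = val z >]].

Lemma boundaries_closed n : zmod_closed (@boundaries n).
Proof.
split=> [|z t]; rewrite !inE; first by apply/asboolP; exists 0; rewrite !raddf0.
move=> /asboolP[c cz] /asboolP[d dt]; apply/asboolP; exists (c - d).
by rewrite [LHS]raddfB [RHS]raddfB /= cz dt.
Qed.

HB.instance Definition _ n := GRing.isZmodClosed.Build
  (cycles n) (@boundaries n) (@boundaries_closed n).

(* H_n(G; Z), trivial action on Z. *)
Definition group_homology (n : nat) : zmodType := Quotient.quot (@boundaries n).

End GroupHomology.

Section FlagComplex.
Variables (T : finType) (e : rel T).

(* The empty set is included, as the simplex of dimension -1. *)
Definition is_simplex (s : {set T}) : bool :=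
  [forall x in s, forall y in s, (x != y) ==> e x y].

Definition simplex := {s : {set T} | is_simplex s}.

Definition dim (s : simplex) : int := #|val s|%:Z - 1.

End FlagComplex.

Definition rho (n k : nat) : int :=
  \sum_(k <= j < n) (-1) ^+ (n.-1 - j) * ('C(j, k))%:Z.

(* The number of indices j with 1 <= j <= rho n (dim s), and 0 for the empty
   simplex.  The sum over j is empty whenever rho n (dim s) < 1. *)
Definition multiplicity (T : finType) (e : rel T) (n : nat) (s : simplex e) : nat :=
  if dim s is Posz k then (if rho n k is Posz m then m else 0%N) else 0%N.

Definition isomorphic (A B : zmodType) : Prop :=
  exists f : {additive A -> B}, bijective f.

(* Main.v *)
(* The homology is read off a free resolution of Z over Z[W] smaller than the bar
   resolution: the product, over each clique of the graph, of the periodic resolutions of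
   the corresponding groups of order two.  It has a basis of multi-indices f : T -> nat
   supported on a clique, with f in degree \sum f.  To see that it is exact, filter the
   cells (w, f) by the length of the longest element u of the coset of w modulo the
   subgroup generated by the support of f.  The graded piece at u is a tensor product of
   contractible complexes, one for each right descent of u.

   On coinvariants the differential is 2 d, where d is a differential that is exact on
   nonzero f.  So for n >= 1 the homology is ker d / 2 ker d, and ker d is free: its
   elements are determined by their coefficients, which may be prescribed freely, at the
   f of degree n whose value at a chosen vertex of the support is odd.  On a support of
   k+1 vertices, let r_n be the number of these f.  Lowering an even value at the chosen
   vertex shows that r_(n+1) + r_n is the number 'C(n, k) of all f of degree n+1 with this
   support, and this is the recursion of rho. *)
Require Import Defs.
From HB Require Import structures.
From mathcomp Require Import all_boot all_order all_algebra.
From mathcomp Require Import boolp ring zify.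
From mathcomp.multinomials Require Import freeg.

Set Implicit Arguments.
Unset Strict Implicit.
Unset Printing Implicit Defensive.

Import GRing.Theory.

Local Open Scope ring_scope.

(** * Free abelian groups and supports *)

Section FreeAbelianGroups.
Variable K : choiceType.
Implicit Types (k : K) (x y z : {freeg K / int}).

(** Closure under subtraction already yields negatives, sums and integer multiples, so a linear
    identity on elements supported in [A] need only be checked on basis elements in [A]. *)
Lemma freeg_ind_in (A : K -> Prop) (P : {freeg K / int} -> Prop) :
  P 0 -> (forall k, A k -> P << k >>) -> (forall x y, P x -> P y -> P (x - y)) ->
  forall z, (forall k, k \in dom z -> A k) -> P z.
Proof.
move=> P0 PU PB z Az.
have PN x : P x -> P (- x) by move=> Px; rewrite -sub0r; apply: PB.
have PD x y : P x -> P y -> P (x + y).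
  by move=> Px Py; rewrite -[y]opprK; apply: PB => //; apply: PN.
have PM x n : P x -> P (x *+ n).
  by move=> Px; elim: n => [|n IHn]; rewrite ?mulr0n // mulrS; apply: PD.
rewrite -[z]freeg_sumE big_seq; elim/big_ind: _ => // k /Az/PU Pk.
have -> : << coeff k z *g k >> = << k >> *~ coeff k z.
  by rewrite freegU_mulz intz.
by case: (coeff k z) => n; rewrite ?NegzE ?mulrNz; [|apply: PN];
  rewrite -pmulrn; apply: PM.
Qed.

Lemma freeg_ind (P : {freeg K / int} -> Prop) :
  P 0 -> (forall k, P << k >>) -> (forall x y, P x -> P y -> P (x - y)) ->
  forall z, P z.
Proof. by move=> P0 PU PB z; apply: (@freeg_ind_in xpredT) => // k _; apply: PU. Qed.

Lemma freeg_scaleE (M : lmodType int) (n : int) (v : M) : n *: v = v *~ n.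
Proof. by rewrite -scaler_int intz. Qed.

Lemma fgliftU (M : lmodType int) (F : K -> M) k : fglift F << k >> = F k.
Proof. by rewrite liftU scale1r. Qed.

HB.instance Definition _ (M : lmodType int) (F : K -> M) :=
  GRing.isZmodMorphism.Build {freeg K / int} M (fglift F) (lift_is_additive F).

Lemma eq_fglift (M : lmodType int) (F F' : K -> M) :
  F =1 F' -> fglift F =1 fglift F'.
Proof.
move=> FF'; elim/freeg_ind=> [|k|x y IHx IHy]; first by rewrite !raddf0.
  by rewrite !fgliftU.
by rewrite !raddfB /= IHx IHy.
Qed.

End FreeAbelianGroups.

Section Supported.
Variable K : choiceType.
Implicit Types (A : K -> Prop) (y z : {freeg K / int}).

(** Membership in the subgroup spanned by the basis elements that satisfy [A]. *)
Definition supported A z := forall k, k \in dom z -> A k.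

Lemma supported_mono A A' z : (forall k, A k -> A' k) -> supported A z -> supported A' z.
Proof. by move=> AA' Az k /Az/AA'. Qed.

Lemma supported0 A : supported A 0.
Proof. by move=> k; rewrite dom0. Qed.

Lemma supportedU A k : A k -> supported A << k >>.
Proof. by move=> Ak k'; rewrite domU1 inE => /eqP ->. Qed.

Lemma supportedD A y z : supported A y -> supported A z -> supported A (y + z).
Proof. by move=> Ay Az k /domD_subset; rewrite mem_cat => /orP[/Ay|/Az]. Qed.

Lemma supportedN A z : supported A z -> supported A (- z).
Proof. by move=> Az k; rewrite domN; exact: Az. Qed.

Lemma supportedB A y z : supported A y -> supported A z -> supported A (y - z).
Proof. by move=> Ay Az; apply: supportedD => //; apply: supportedN. Qed.

Lemma supportedMz A z n : supported A z -> supported A (z *~ n).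
Proof. by rewrite -freeg_scaleE => Az k /domZ_subset; apply: Az. Qed.

Lemma supported_sum A (I : Type) (r : seq I) (P : pred I) (F : I -> {freeg K / int}) :
  (forall i, P i -> supported A (F i)) -> supported A (\sum_(i <- r | P i) F i).
Proof. move=> AF; elim/big_ind: _ => [|y z|i /AF //]; first exact: supported0.
exact: supportedD. Qed.

End Supported.

Lemma supported_fglift (K K' : choiceType) (A : K -> Prop) (A' : K' -> Prop)
    (F : K -> {freeg K' / int}) z :
  (forall k, A k -> supported A' (F k)) -> supported A z -> supported A' (fglift F z).
Proof.
move=> AF; move: z; apply: freeg_ind_in => [|k Ak|y z IHy IHz].
- by rewrite raddf0; apply: supported0.
- by rewrite fgliftU; apply: AF.
- by rewrite raddfB; apply: supportedB.
Qed.

Lemma coeffMz (K : choiceType) (k : K) (z : {freeg K / int}) (n : int) :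
  coeff k (z *~ n) = coeff k z * n.
Proof. by rewrite raddfMz /= mulrzz. Qed.

Variant sign_spec : int -> Type :=
| SignPos : sign_spec 1
| SignNeg : sign_spec (-1).

Lemma signP n : sign_spec ((-1) ^+ n).
Proof. by rewrite -signr_odd; case: (odd n); constructor. Qed.

(** Compares coefficients at an arbitrary basis element and generalizes those that occur, which
    leaves an identity between integers. *)
Ltac freeg_ring := apply/eqP/freeg_eqP => ?; rewrite ?(coeff0, coeffD, coeffN, coeffMz);
  do ?[move: (coeff _ _) => ?].

Lemma freeg_torsion_free (K : choiceType) (z : {freeg K / int}) : z = - z -> z = 0.
Proof.
move=> zN; apply/eqP/freeg_eqP => k; rewrite coeff0.
by move: (congr1 (coeff k) zN); rewrite coeffN; lia.
Qed.

Lemma freeg_mulz_eq0 (K : choiceType) (z : {freeg K / int}) (n : int) :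
  n != 0 -> z *~ n = 0 -> z = 0.
Proof.
move=> n0 zn; apply/eqP/freeg_eqP => k; rewrite coeff0.
have /eqP := congr1 (coeff k) zn; rewrite coeffMz coeff0 mulf_eq0 (negbTE n0) orbF.
by move/eqP.
Qed.

Lemma supportedMz_inv (K : choiceType) (A : K -> Prop) (z : {freeg K / int}) (n : int) :
  n != 0 -> supported A (z *~ n) -> supported A z.
Proof.
by move=> n0 Az k kz; apply: Az; rewrite mem_dom coeffMz mulf_eq0 negb_or n0 andbT -mem_dom.
Qed.

(** Basis elements killed by [F] do not contribute, and the coefficients of the others can be
    halved. *)
Lemma fglift_even (K K' : choiceType) (F : K -> {freeg K' / int}) (z : {freeg K / int}) :
  (forall k, F k = 0 \/ (2 %| coeff k z)%Z) -> exists c, fglift F z = c *~ 2.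
Proof.
move=> Fz; exists (\sum_(k <- dom z) F k *~ (coeff k z %/ 2)%Z).
rewrite -{1}[z]freeg_sumE raddf_sum mulrz_suml; apply: eq_bigr => k _ /=.
rewrite liftU freeg_scaleE -mulrzA.
by case: (Fz k) => [->|/divzK -> //]; rewrite !mul0rz.
Qed.

(** * Comparison of free resolutions *)

(* [{freeg (G * B) / int}] is the free Z[G]-module on [B]; [gext phi] is the Z[G]-linear
   extension of [phi] and [coext phi] the map that it induces on coinvariants. *)
Section FreeModules.
Variable G : groupType.
Implicit Types (g : G) (B : choiceType).

Local Notation fmod B := {freeg (G * B)%type / int}.

Definition gact B g : fmod B -> fmod B :=
  fglift (fun p : G * B => << ((g * p.1)%g, p.2) >> : fmod B).
HB.instance Definition _ B g := GRing.Additive.on (@gact B g).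

Definition gext B B' (phi : B -> fmod B') : fmod B -> fmod B' :=
  fglift (fun p : G * B => gact p.1 (phi p.2)).
HB.instance Definition _ B B' phi := GRing.Additive.on (@gext B B' phi).

Definition coinv B : fmod B -> {freeg B / int} :=
  fglift (fun p : G * B => << p.2 >> : {freeg B / int}).
HB.instance Definition _ B := GRing.Additive.on (@coinv B).

Lemma gactU B g (p : G * B) : gact g << p >> = << ((g * p.1)%g, p.2) >>.
Proof. exact: fgliftU. Qed.

Lemma gact1 B (z : fmod B) : gact 1 z = z.
Proof.
elim/freeg_ind: z => [|[g b]|x y IHx IHy]; first by rewrite raddf0.
  by rewrite gactU /= mul1g.
by rewrite raddfB /= IHx IHy.
Qed.

Lemma gactM B g h (z : fmod B) : gact g (gact h z) = gact (g * h) z.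
Proof.
elim/freeg_ind: z => [|[k b]|x y IHx IHy]; first by rewrite !raddf0.
  by rewrite !gactU /= mulgA.
by rewrite !raddfB /= IHx IHy.
Qed.

Lemma gextU B B' (phi : B -> fmod B') g b :
  gext phi << (g, b) >> = gact g (phi b).
Proof. exact: fgliftU. Qed.

Lemma gext1U B B' (phi : B -> fmod B') b : gext phi << (1%g, b) >> = phi b.
Proof. by rewrite gextU gact1. Qed.

Lemma gext_act B B' (phi : B -> fmod B') g z :
  gext phi (gact g z) = gact g (gext phi z).
Proof.
elim/freeg_ind: z => [|[k b]|x y IHx IHy]; first by rewrite !raddf0.
  by rewrite gactU !gextU gactM.
by rewrite !raddfB /= IHx IHy.
Qed.

Lemma gext_id B (z : fmod B) : gext (fun b => << (1%g, b) >>) z = z.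
Proof.
elim/freeg_ind: z => [|[k b]|x y IHx IHy]; first by rewrite !raddf0.
  by rewrite gextU gactU mulg1.
by rewrite !raddfB /= IHx IHy.
Qed.

Lemma gext_comp B B' B'' (phi : B -> fmod B') (psi : B' -> fmod B'') z :
  gext (fun b => gext psi (phi b)) z = gext psi (gext phi z).
Proof.
elim/freeg_ind: z => [|[k b]|x y IHx IHy]; first by rewrite !raddf0.
  by rewrite !gextU gext_act.
by rewrite !raddfB /= IHx IHy.
Qed.

Lemma gext_sub B B' (phi psi : B -> fmod B') z :
  gext (fun b => phi b - psi b) z = gext phi z - gext psi z.
Proof.
elim/freeg_ind: z => [|[k b]|x y IHx IHy]; first by rewrite !raddf0 addr0.
  by rewrite !gextU raddfB.
by rewrite !raddfB /= IHx IHy !opprD addrACA.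
Qed.

Lemma eq_gext B B' (phi psi : B -> fmod B') : phi =1 psi -> gext phi =1 gext psi.
Proof. by move=> pq; apply: eq_fglift => p; rewrite pq. Qed.

Lemma deg_gact B g (z : fmod B) : deg (gact g z) = deg z.
Proof.
elim/freeg_ind: z => [|[k b]|x y IHx IHy]; first by rewrite !raddf0.
  by rewrite gactU !degU.
by rewrite !raddfB /= IHx IHy.
Qed.

Lemma coinvU B (p : G * B) : coinv << p >> = << p.2 >>.
Proof. exact: fgliftU. Qed.

Lemma coinv_act B g (z : fmod B) : coinv (gact g z) = coinv z.
Proof.
elim/freeg_ind: z => [|[k b]|x y IHx IHy]; first by rewrite !raddf0.
  by rewrite gactU !coinvU.
by rewrite !raddfB /= IHx IHy.
Qed.

Definition coext B B' (phi : B -> fmod B') : {freeg B / int} -> {freeg B' / int} :=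
  fglift (fun b => coinv (phi b)).
HB.instance Definition _ B B' phi := GRing.Additive.on (@coext B B' phi).

Lemma coextU B B' (phi : B -> fmod B') b : coext phi << b >> = coinv (phi b).
Proof. exact: fgliftU. Qed.

Lemma coinv_gext B B' (phi : B -> fmod B') z :
  coinv (gext phi z) = coext phi (coinv z).
Proof.
elim/freeg_ind: z => [|[k b]|x y IHx IHy]; first by rewrite !raddf0.
  by rewrite gextU coinv_act coinvU coextU.
by rewrite !raddfB /= IHx IHy.
Qed.

(* Free resolutions of Z whose augmentation is the sum of the coefficients. *)
Record resolution := Resolution {
  rbasis : nat -> choiceType;
  rpoint : rbasis 0;
  rdiff : forall n, rbasis n.+1 -> fmod (rbasis n);
  deg_rdiff : forall b, deg (@rdiff 0 b) = 0;
  rdiff2 : forall n b, gext (@rdiff n) (@rdiff n.+1 b) = 0;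
  rexact0 : forall z, deg z = 0 -> exists c, gext (@rdiff 0) c = z;
  rexactS : forall n z, gext (@rdiff n) z = 0 -> exists c, gext (@rdiff n.+1) c = z
}.

Local Notation D R n := (gext (@rdiff R n)).

Section ChainMaps.
Variables A R : resolution.

(** The augmentation sends every basis element to 1, so the first clause is compatibility with
    augmentations. *)
Definition chain_map (phi : forall n, rbasis A n -> fmod (rbasis R n)) :=
  (forall b, deg (phi 0%N b) = 1) /\
  forall n b, D R n (phi n.+1 b) = gext (phi n) (rdiff b).

Lemma chain_mapE phi n z : chain_map phi ->
  D R n (gext (phi n.+1) z) = gext (phi n) (D A n z).
Proof.
case=> _ phiD; elim/freeg_ind: z => [|[k b]|x y IHx IHy].
- by rewrite !raddf0.
- by rewrite !gextU !gext_act phiD.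
- by rewrite !raddfB /= IHx IHy.
Qed.

Lemma chain_map_deg phi z : chain_map phi -> deg (gext (phi 0%N) z) = deg z.
Proof.
case=> phi0 _; elim/freeg_ind: z => [|[k b]|x y IHx IHy].
- by rewrite !raddf0.
- by rewrite !gextU deg_gact phi0 degU.
- by rewrite !raddfB /= IHx IHy.
Qed.

(** A chosen preimage under the differential; 0 is a default where there is none. *)
Definition fill n (z : fmod (rbasis R n)) : fmod (rbasis R n.+1) :=
  if pselect (exists c, D R n c = z) is left h then sval (cid h) else 0.

Lemma fillK n z : (exists c, D R n c = z) -> D R n (fill z) = z.
Proof. by rewrite /fill; case: pselect => // h _; case: cid. Qed.

Fixpoint lift_map n : rbasis A n -> fmod (rbasis R n) :=
  if n is m.+1 then fun b => fill (gext (@lift_map m) (rdiff b))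
  else fun=> << (1%g, rpoint R) >>.

(** The comparison theorem: the part of the map already built sends the differential of a basis
    element to a cycle, and exactness of [R] makes it a boundary, so that [fill] returns a
    preimage. *)
Lemma lift_mapP : chain_map lift_map.
Proof.
split=> [b|n b] /=; first by rewrite degU.
elim: n b => [|n IHn] b /=; apply: fillK.
  apply: rexact0; rewrite -[RHS](deg_rdiff b).
  elim/freeg_ind: (rdiff b) => [|[k c]|x y IHx IHy]; first by rewrite !raddf0.
    by rewrite gextU deg_gact !degU.
  by rewrite !raddfB /= IHx IHy.
apply: rexactS.
suff -> : D R n (gext (@lift_map n.+1) (rdiff b)) = gext (@lift_map n) (D A n (rdiff b)).
  by rewrite rdiff2 raddf0.
elim/freeg_ind: (rdiff b) => [|[k c]|x y IHx IHy]; first by rewrite !raddf0.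
  by rewrite !gextU !gext_act -IHn.
by rewrite !raddfB /= IHx IHy.
Qed.

Section Homotopy.
Variables phi psi : forall n, rbasis A n -> fmod (rbasis R n).
Hypotheses (phiP : chain_map phi) (psiP : chain_map psi).

Fixpoint homotopy n : rbasis A n -> fmod (rbasis R n.+1) :=
  if n is m.+1 then
    fun b => fill (phi b - psi b - gext (@homotopy m) (rdiff b))
  else fun b => fill (phi b - psi b).

Lemma homotopy0 z :
  D R 0 (gext (@homotopy 0) z) = gext (@phi 0%N) z - gext (@psi 0%N) z.
Proof.
elim/freeg_ind: z => [|[k b]|x y IHx IHy]; first by rewrite !raddf0 addr0.
  rewrite !gextU gext_act /= fillK ?raddfB //.
  by apply: rexact0; rewrite raddfB /= phiP.1 psiP.1 subrr.
by rewrite !raddfB /= IHx IHy !opprD addrACA.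
Qed.

(** The right-hand side is a cycle on basis elements by the same identity one degree lower, so
    exactness makes the value of [fill] a genuine preimage. *)
Lemma homotopyS n z :
  D R n.+1 (gext (@homotopy n.+1) z) =
  gext (@phi n.+1) z - gext (@psi n.+1) z - gext (@homotopy n) (D A n z).
Proof.
rewrite -gext_sub -[gext (@homotopy n) _]gext_comp -gext_sub.
have key b : D R n.+1 (@homotopy n.+1 b) =
    phi b - psi b - gext (@homotopy n) (rdiff b).
  elim: n b {z} => [|n IHn] b; apply: fillK; apply: rexactS; rewrite !raddfB /=.
    by rewrite homotopy0 phiP.2 psiP.2 subrr.
  suff -> z : D R n.+1 (gext (@homotopy n.+1) z) =
      gext (@phi n.+1) z - gext (@psi n.+1) z - gext (@homotopy n) (D A n z).
    by rewrite phiP.2 psiP.2 rdiff2 raddf0 subr0 subrr.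
  rewrite -gext_sub -[gext (@homotopy n) _]gext_comp -gext_sub.
  by rewrite -gext_comp; apply: eq_gext.
by rewrite -gext_comp; apply: eq_gext.
Qed.

End Homotopy.
End ChainMaps.

Definition coinv_cycle (R : resolution) n (z : {freeg (rbasis R n.+1) / int}) :=
  coext (@rdiff R n) z = 0.

Definition coinv_boundary (R : resolution) n (z : {freeg (rbasis R n.+1) / int}) :=
  exists c, coext (@rdiff R n.+1) c = z.

Lemma coinv_boundaryD (R : resolution) n (y z : {freeg (rbasis R n.+1) / int}) :
  coinv_boundary y -> coinv_boundary z -> coinv_boundary (y + z).
Proof. by move=> [c <-] [d <-]; exists (c + d); rewrite raddfD. Qed.

Lemma coinv_boundaryN (R : resolution) n (z : {freeg (rbasis R n.+1) / int}) :
  coinv_boundary z -> coinv_boundary (- z).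
Proof. by move=> [c <-]; exists (- c); rewrite raddfN. Qed.

Lemma coext_chain_map A R phi n x : @chain_map A R phi ->
  coext (@rdiff R n) (coext (phi n.+1) x) = coext (phi n) (coext (@rdiff A n) x).
Proof.
move=> phiP; elim/freeg_ind: x => [|b|x y IHx IHy].
- by rewrite !raddf0.
- by rewrite !coextU -!coinv_gext phiP.2.
- by rewrite !raddfB /= IHx IHy.
Qed.

(** The composite and the identity are both chain maps from [A] to itself, hence homotopic; on a
    cycle, the term of the homotopy formula that applies the differential first vanishes. *)
Lemma coinv_chain_map_comp A R phi psi n (z : {freeg (rbasis A n.+1) / int}) :
  @chain_map A R phi -> @chain_map R A psi -> coinv_cycle z ->
  coinv_boundary (coext (psi n.+1) (coext (phi n.+1) z) - z).
Proof.
move=> phiP psiP z0.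
pose chi n b := gext (psi n) (phi n b).
have chiP : chain_map chi.
  split=> [b|k b]; first by rewrite chain_map_deg // phiP.1.
  by rewrite /chi chain_mapE // phiP.2 gext_comp.
pose id_map n (b : rbasis A n) : fmod (rbasis A n) := << (1%g, b) >>.
have idP : chain_map id_map.
  by split=> [b|k b]; rewrite ?degU // gext1U gext_id.
exists (coext (homotopy chi id_map (n:=n.+1)) z).
have -> : coext (@rdiff A n.+1) (coext (homotopy chi id_map (n:=n.+1)) z) =
    coext (psi n.+1) (coext (phi n.+1) z) - z -
    coext (homotopy chi id_map (n:=n)) (coext (@rdiff A n) z).
  elim/freeg_ind: z {z0} => [|b|x y IHx IHy].
  - by rewrite !raddf0 !addr0.
  - rewrite !coextU -!coinv_gext -[homotopy _ _ b]gext1U homotopyS //.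
    by rewrite !raddfB /= !gext1U coinvU.
  - rewrite !raddfB /= IHx IHy !opprD !opprK addrACA.
    by congr (_ + _); rewrite addrACA.
by rewrite z0 raddf0 subr0.
Qed.

(** The homology of coinvariants does not depend on the resolution. The clauses express a
    well-defined, injective and surjective map on homology without forming quotients. *)
Lemma coinv_homology_equiv (A R : resolution) n :
  exists F : {additive {freeg (rbasis A n.+1) / int} -> {freeg (rbasis R n.+1) / int}},
    [/\ forall z, coinv_cycle z -> coinv_cycle (F z),
        forall z, coinv_cycle z -> coinv_boundary (F z) <-> coinv_boundary z
      & forall y, coinv_cycle y -> exists2 z, coinv_cycle z & coinv_boundary (F z - y)].
Proof.
have phiP := lift_mapP A R; have psiP := lift_mapP R A.
have cycle_map A' R' phi : @chain_map A' R' phi ->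
    forall z : {freeg (rbasis A' n.+1) / int},
    coinv_cycle z -> coinv_cycle (coext (phi n.+1) z).
  by move=> chP z z0; rewrite /coinv_cycle coext_chain_map // z0 raddf0.
have bound_map A' R' phi : @chain_map A' R' phi ->
    forall z : {freeg (rbasis A' n.+1) / int},
    coinv_boundary z -> coinv_boundary (coext (phi n.+1) z).
  move=> chP z [c <-]; exists (coext (phi n.+2) c); exact: coext_chain_map.
exists (coext (@lift_map A R n.+1)); split=> [z|z z0|y y0].
- exact: cycle_map.
- split=> [|/bound_map]; last exact.
  move=> /(bound_map _ _ _ psiP) bz.
  have := coinv_chain_map_comp phiP psiP z0.
  move=> /coinv_boundaryN /(coinv_boundaryD bz); by rewrite subKr.
- exists (coext (@lift_map R A n.+1) y); first exact: cycle_map.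
  exact: coinv_chain_map_comp.
Qed.

End FreeModules.

(** * The bar resolution *)

Section BarResolution.
Variable G : groupType.

Local Notation fmod B := {freeg (G * B)%type / int}.

Lemma bar_face0_cons n g (t : n.-tuple G) : bar_face ord0 [tuple of g :: t] = t.
Proof. by apply: eq_from_tnth => j; rewrite tnth_mktuple /= tnthS. Qed.

Lemma widen_lift0 n (k : 'I_n) :
  widen_ord (leqnSn n.+1) (fintype.lift ord0 k) =
  fintype.lift ord0 (widen_ord (leqnSn n) k).
Proof. exact: val_inj. Qed.

Lemma widen0 n : widen_ord (leqnSn n.+1) ord0 = ord0.
Proof. exact: val_inj. Qed.

Lemma bar_face1_cons n g (t : n.+1.-tuple G) :
  bar_face (fintype.lift ord0 ord0) [tuple of g :: t] =
  [tuple of (g * thead t)%g :: bar_face ord0 t].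
Proof.
apply: eq_from_tnth => j; rewrite tnth_mktuple.
case: (unliftP ord0 j) => [k|] ->; last by rewrite widen0 tnthS !tnth0.
by rewrite [RHS]tnthS tnth_mktuple /= tnthS.
Qed.

Lemma bar_faceSS_cons n g (t : n.+1.-tuple G) (i : 'I_n.+1) :
  bar_face (fintype.lift ord0 (fintype.lift ord0 i)) [tuple of g :: t] =
  [tuple of g :: bar_face (fintype.lift ord0 i) t].
Proof.
apply: eq_from_tnth => j; rewrite tnth_mktuple.
case: (unliftP ord0 j) => [k|] ->; last by rewrite widen0 !tnth0.
by rewrite [RHS]tnthS tnth_mktuple widen_lift0 !tnthS.
Qed.

(** In the free resolution the letter dropped by face 0 survives as the group coefficient. *)
Definition bar_rdiff n (t : n.+1.-tuple G) : fmod (n.-tuple G) :=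
  << (thead t, bar_face ord0 t) >> +
  \sum_(i < n.+1) << (1%g, bar_face (fintype.lift ord0 i) t) >> *~ (-1) ^+ i.+1.

Local Notation D n := (gext (@bar_rdiff n)).

(** The standard contraction, which moves the group coefficient into the first slot; it is additive
    but not [G]-linear. *)
Definition bar_contract n : fmod (n.-tuple G) -> fmod (n.+1.-tuple G) :=
  fglift (fun p : G * n.-tuple G =>
    << (1%g, [tuple of p.1 :: p.2]) >> : fmod (n.+1.-tuple G)).
HB.instance Definition _ n := GRing.Additive.on (@bar_contract n).

Lemma bar_contractU n g (t : n.-tuple G) :
  bar_contract << (g, t) >> = << (1%g, [tuple of g :: t]) >>.
Proof. exact: fgliftU. Qed.

Lemma bar_contract0 (z : fmod (0.-tuple G)) :
  D 0 (bar_contract z) = z - << (1%g, [tuple]) >> *~ deg z.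
Proof.
elim/freeg_ind: z => [|[g t]|x y IHx IHy]; first by rewrite !raddf0 addr0.
  rewrite bar_contractU gext1U degU /bar_rdiff big_ord1 bar_face0_cons.
  by rewrite expr1 mulrN1z theadE; rewrite !(tuple0 (bar_face _ _)) (tuple0 t).
by rewrite !raddfB /= IHx IHy !opprD opprK addrACA.
Qed.

(** Face 0 of [g :: t] gives back [(g, t)]; the later faces come from the faces of [t] with the
    index shifted by one, hence with the opposite sign. *)
Lemma bar_contractS n (z : fmod (n.+1.-tuple G)) :
  D n.+1 (bar_contract z) = z - bar_contract (D n z).
Proof.
elim/freeg_ind: z => [|[g t]|x y IHx IHy]; first by rewrite !raddf0 addr0.
  rewrite bar_contractU gext1U gextU /bar_rdiff big_ord_recl /=.
  rewrite bar_face0_cons bar_face1_cons expr1 mulrN1z theadE.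
  rewrite raddfD /= gactU raddfD /= bar_contractU opprD; congr (_ + (_ + _)).
  rewrite !raddf_sum; apply: eq_bigr => i _ /=.
  rewrite bar_faceSS_cons !raddfMz /= gactU bar_contractU /= mulg1.
  by rewrite [in LHS]exprS mulN1r mulrNz mulNrz.
by rewrite !raddfB /= IHx IHy !opprD opprK addrACA.
Qed.

Lemma bar_rdiff_deg (t : 1.-tuple G) : deg (bar_rdiff t) = 0.
Proof. by rewrite /bar_rdiff big_ord1 raddfD /= raddfMz /= !degU. Qed.

(* As [bar_contract] hits every [(1, t)], the square of the differential vanishes by
   induction on the degree; no simplicial identities are needed. *)
Lemma bar_rdiff2 n (t : n.+2.-tuple G) : D n (bar_rdiff t) = 0.
Proof.
elim: n t => [|n IHn] t; rewrite -[bar_rdiff t]gext1U;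
  case/tupleP: t => g t; rewrite -bar_contractU bar_contractS raddfB /=.
  rewrite bar_contract0 gextU deg_gact bar_rdiff_deg mulr0z subr0.
  by rewrite subrr.
by rewrite bar_contractS gextU gext_act IHn !raddf0 addr0 subrr.
Qed.

Lemma bar_exact0 (z : fmod (0.-tuple G)) : deg z = 0 -> exists c, D 0 c = z.
Proof.
by move=> z0; exists (bar_contract z); rewrite bar_contract0 z0 mulr0z subr0.
Qed.

Lemma bar_exactS n (z : fmod (n.+1.-tuple G)) : D n z = 0 -> exists c, D n.+1 c = z.
Proof.
by move=> z0; exists (bar_contract z); rewrite bar_contractS z0 raddf0 subr0.
Qed.

Definition bar_resolution : resolution G :=
  @Resolution G (fun n => n.-tuple G : choiceType) [tuple] bar_rdiff
    bar_rdiff_deg bar_rdiff2 bar_exact0 bar_exactS.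

(** Identifies the coinvariants of the bar resolution with the complex that defines
    [group_homology]. *)
Lemma coext_bar_rdiff n (z : bar_chain G n.+1) :
  coext (@bar_rdiff n) z = bar_diff z.
Proof.
elim/freeg_ind: z => [|t|x y IHx IHy]; first by rewrite !raddf0.
  rewrite coextU /bar_diff fgliftU big_ord_recl expr0 scale1r raddfD /=.
  rewrite coinvU raddf_sum /=; congr (_ + _); apply: eq_bigr => i _.
  by rewrite raddfMz /= coinvU freeg_scaleE.
by rewrite !raddfB /= IHx IHy.
Qed.

End BarResolution.

(** * Descents in right-angled Coxeter groups *)

Section NormalForms.
Variables (T : finType) (e : rel T).
Hypotheses (e_sym : symmetric e) (e_irr : irreflexive e).
Implicit Types (u w : seq T) (x y v : T).

(* Reduced words are stored with their last letter first, so [desc u v] says that the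
   element spelled by [u] has a reduced word ending in [v], and [act u v] multiplies it
   by [v] on the right. *)
Fixpoint desc u v :=
  if u is y :: u' then (y == v) || (e y v && desc u' v) else false.

Definition act u v := if desc u v then rem v u else v :: u.

Fixpoint reduced_word u :=
  if u is y :: u' then ~~ desc u' y && reduced_word u' else true.

(** The moves that relate the reduced words of one element; symmetry follows from that of [e]. *)
Inductive comm_equiv : seq T -> seq T -> Prop :=
| CommRefl u : comm_equiv u u
| CommTrans u1 u2 u3 : comm_equiv u1 u2 -> comm_equiv u2 u3 -> comm_equiv u1 u3
| CommSwap p u x y : e x y -> comm_equiv (p ++ [:: x, y & u]) (p ++ [:: y, x & u]).

Lemma adj_neq x y : e x y -> (x == y) = false.
Proof. by apply: contraTF => /eqP ->; rewrite e_irr. Qed.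

Lemma comm_equiv_sym u w : comm_equiv u w -> comm_equiv w u.
Proof.
elim=> {u w} [u|u1 u2 u3 _ IH1 _ IH2|p u x y exy]; first exact: CommRefl.
  exact: CommTrans IH2 IH1.
by apply: CommSwap; rewrite e_sym.
Qed.

Lemma comm_equiv_cons x u w : comm_equiv u w -> comm_equiv (x :: u) (x :: w).
Proof.
elim=> {u w} [u|u1 u2 u3 _ IH1 _ IH2|p u y z eyz]; first exact: CommRefl.
  exact: CommTrans IH1 IH2.
by rewrite -!cat_cons; apply: CommSwap.
Qed.

Lemma comm_equiv_size u w : comm_equiv u w -> size u = size w.
Proof. by elim=> {u w} // [u1 u2 u3 _ -> _ //|p u x y _]; rewrite !size_cat. Qed.

Lemma comm_equiv_desc u w : comm_equiv u w -> desc u =1 desc w.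
Proof.
elim=> {u w} // [u1 u2 u3 _ IH1 _ IH2 v|p u x y exy v]; first by rewrite IH1.
elim: p => [|z p IHp] /=; last by rewrite IHp.
have eyx : e y x by rewrite e_sym.
case: (eqVneq x v) => [<-|xv] /=; first by rewrite eyx orbT.
by case: (eqVneq y v) => [<-|yv] /=; rewrite ?exy // andbCA.
Qed.

Lemma comm_equiv_act u w v : comm_equiv u w -> comm_equiv (act u v) (act w v).
Proof.
elim=> {u w} [u|u1 u2 u3 _ IH1 _ IH2|p u x y exy]; first exact: CommRefl.
  exact: CommTrans IH1 IH2.
rewrite /act (comm_equiv_desc (CommSwap p u exy)); case: ifP => _; last first.
  by rewrite -!cat_cons; apply: CommSwap.
elim: p => [|z p IHp] /=; last first.
  by case: eqP => _; [apply: CommSwap | apply: comm_equiv_cons].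
case: (eqVneq x v) => [<-|xv].
  by rewrite [y == x]eq_sym adj_neq // ?eqxx; apply: CommRefl.
case: (eqVneq y v) => [_|yv]; first exact: CommRefl.
exact: (@CommSwap [::]).
Qed.

Lemma desc_mem u v : desc u v -> v \in u.
Proof.
by elim: u => //= y u IHu; rewrite inE eq_sym; case: eqP => //= _ /andP[_ /IHu].
Qed.

(** Whichever of the two letters is met second along [u] has to commute past the other to be a
    descent. *)
Lemma desc_clique u x y : desc u x -> desc u y -> x != y -> e x y.
Proof.
elim: u => //= z u IHu; case: (eqVneq z x) => [->|zx] /=.
  by move=> _; case: (x == y) => //= /andP[].
case: (eqVneq z y) => [->|zy] /=; first by rewrite e_sym => /andP[].
by move=> /andP[_ ux] /andP[_ uy]; apply: IHu.
Qed.

Lemma comm_equiv_rem u v : desc u v -> comm_equiv u (v :: rem v u).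
Proof.
elim: u => //= y u IHu; case: (eqVneq y v) => [-> _|yv /= /andP[eyv /IHu uv]].
  exact: CommRefl.
apply: CommTrans (comm_equiv_cons y uv) _.
exact: (@CommSwap [::]).
Qed.

Lemma desc_rem_adj u x v : e x v -> desc (rem v u) x = desc u x.
Proof.
move=> exv; elim: u => //= y u IHu; case: (eqVneq y v) => [->|_] /=; last by rewrite IHu.
by rewrite eq_sym adj_neq // e_sym exv.
Qed.

Lemma desc_act_adj u x v : e x v -> desc (act u v) x = desc u x.
Proof.
rewrite /act => exv; case: ifP => _; first exact: desc_rem_adj.
by rewrite /= eq_sym adj_neq // e_sym exv.
Qed.

Lemma desc_rem u v : reduced_word u -> desc u v -> desc (rem v u) v = false.
Proof.
elim: u => //= y u IHu /andP[uy ru]; case: (eqVneq y v) => [<- _|yv /=].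
  exact/negbTE.
by rewrite (negbTE yv) /= => /andP[_ /(IHu ru) ->]; rewrite andbF.
Qed.

Lemma desc_act u v : reduced_word u -> desc (act u v) v = ~~ desc u v.
Proof.
by rewrite /act => ru; case: ifP => [uv|_]; rewrite ?desc_rem //= eqxx.
Qed.

Lemma reduced_act u v : reduced_word u -> reduced_word (act u v).
Proof.
rewrite /act; case: ifP => [|uv ru]; last by rewrite /= uv.
elim: u => //= y u IHu; case: (eqVneq y v) => [_ _ /andP[]//|yv /=].
by move=> /andP[eyv uv] /andP[uy ru]; rewrite desc_rem_adj // uy IHu.
Qed.

Lemma size_act u v : size (act u v) = if desc u v then (size u).-1 else (size u).+1.
Proof. by rewrite /act; case: ifP => // /desc_mem; apply: size_rem. Qed.

Lemma actK u v : reduced_word u -> comm_equiv (act (act u v) v) u.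
Proof.
move=> ru; rewrite {1}/act desc_act // if_neg /act; case: ifP => uv; rewrite ?uv.
  exact/comm_equiv_sym/comm_equiv_rem.
by rewrite /= eqxx; apply: CommRefl.
Qed.

Lemma rem_comm u x y : rem x (rem y u) = rem y (rem x u).
Proof.
elim: u => //= z u IHu; case: (eqVneq z y) => [->|zy].
  by case: (eqVneq y x) => [->//|yx] /=; rewrite eqxx.
case: (eqVneq z x) => [->|zx] /=; first by rewrite eqxx.
by rewrite (negbTE zx) (negbTE zy) IHu.
Qed.

Lemma actC u x y : e x y -> comm_equiv (act (act u x) y) (act (act u y) x).
Proof.
move=> exy; have eyx : e y x by rewrite e_sym.
have actE a b : e a b -> act (act u a) b = if desc u b then rem b (act u a) else b :: act u a.
  by move=> eab; rewrite {1}/act desc_act_adj // e_sym.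
rewrite !actE // /act.
case: (desc u x); case: (desc u y); rewrite /= ?(adj_neq exy) ?(adj_neq eyx).
- by rewrite rem_comm; apply: CommRefl.
- exact: CommRefl.
- exact: CommRefl.
- exact: (@CommSwap [::]).
Qed.

Definition nf w := foldl act [::] w.

Lemma comm_equiv_foldl u1 u2 w :
  comm_equiv u1 u2 -> comm_equiv (foldl act u1 w) (foldl act u2 w).
Proof. by elim: w u1 u2 => //= x w IHw u1 u2 u12; apply/IHw/comm_equiv_act. Qed.

Lemma reduced_nf w : reduced_word (nf w).
Proof.
rewrite /nf; elim/last_ind: w => // w x IHw.
by rewrite -cats1 foldl_cat; apply: reduced_act.
Qed.

(** By [actK] and [actC], [act] respects the defining relations up to commutation, so words act on
    commutation classes of reduced words. This makes descents and length well defined on group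
    elements. *)
Lemma nf_congr w1 w2 : racg_congr e w1 w2 -> comm_equiv (nf w1) (nf w2).
Proof.
elim=> {w1 w2} [w|w1 w2 _|w1 w2 w3 _ IH1 _ IH2|w1 w2 x|w1 w2 x y exy].
- exact: CommRefl.
- exact: comm_equiv_sym.
- exact: CommTrans IH1 IH2.
- rewrite /nf !foldl_cat /=; apply/comm_equiv_foldl/actK; exact: reduced_nf.
- by rewrite /nf !foldl_cat /=; apply/comm_equiv_foldl/actC.
Qed.

Lemma comm_equiv_congr u1 u2 : comm_equiv u1 u2 -> racg_congr e (rev u1) (rev u2).
Proof.
elim=> {u1 u2} [u|u1 u2 u3 _ IH1 _ IH2|p u x y exy].
- exact: RacgRefl.
- exact: RacgTrans IH1 IH2.
- rewrite !rev_cat !rev_cons -!cats1 -!catA; apply: RacgComm.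
  by rewrite e_sym.
Qed.

(** Each step of [act] either appends the new letter or cancels it against an equal letter that
    commutes to the end. *)
Lemma nfK w : racg_congr e (rev (nf w)) w.
Proof.
elim/last_ind: w => [|w x IHw]; first exact: RacgRefl.
rewrite -cats1 /nf foldl_cat /= -/(nf w).
apply: RacgTrans (racg_congr_catr [:: x] IHw); rewrite /act; case: ifP => [ux|_].
  apply: RacgSym; have := comm_equiv_congr (comm_equiv_rem ux).
  move=> /(racg_congr_catr [:: x])/RacgTrans; apply.
  rewrite rev_cons -cats1 -catA -[X in racg_congr _ _ X]cats0.
  exact: (RacgSquare _ _ [::]).
by rewrite rev_cons -cats1; apply: RacgRefl.
Qed.

Local Notation W := (racg e).

Definition gen v : W := \pi_(racg e)%qT [:: v].
(** The chosen representative is harmless: by [nf_congr] another one changes the normal form only by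
    commutations, which [desc] does not see. *)
Definition rdesc (g : W) v := desc (nf (repr g)) v.
Definition rlen (g : W) := size (nf (repr g)).

Lemma nf_mul_gen (g : W) v : comm_equiv (nf (repr (g * gen v)%g)) (act (nf (repr g)) v).
Proof.
have -> : act (nf (repr g)) v = nf (repr g ++ [:: v]) by rewrite /nf foldl_cat.
apply: nf_congr; apply: RacgTrans (racg_repr_pi _ _) _.
exact/racg_congr_catl/racg_repr_pi.
Qed.

Lemma rdesc_mul_gen g v : rdesc (g * gen v)%g v = ~~ rdesc g v.
Proof. by rewrite /rdesc (comm_equiv_desc (nf_mul_gen g v)) desc_act ?reduced_nf. Qed.

Lemma rdesc_mul_adj g x v : e x v -> rdesc (g * gen v)%g x = rdesc g x.
Proof.
by move=> exv; rewrite /rdesc (comm_equiv_desc (nf_mul_gen g v)) desc_act_adj.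
Qed.

Lemma rdesc_clique g x y : rdesc g x -> rdesc g y -> x != y -> e x y.
Proof. exact: desc_clique. Qed.

Lemma rlen_mul_gen g v :
  rlen (g * gen v)%g = if rdesc g v then (rlen g).-1 else (rlen g).+1.
Proof. by rewrite /rlen (comm_equiv_size (nf_mul_gen g v)) size_act. Qed.

Lemma rdesc_rlen g v : rdesc g v -> (0 < rlen g)%N.
Proof. by rewrite /rdesc /rlen; case: (nf _). Qed.

(** The head of a non-empty normal form is a descent, so here the normal form is empty. *)
Lemma rdesc0 g : (forall v, ~~ rdesc g v) -> g = 1%g.
Proof.
rewrite /rdesc => g0; rewrite -[g]reprK; apply/racg_piP.
apply: RacgSym; apply: RacgTrans (nfK (repr g)).
case: (nf _) g0 => [_|x u /(_ x)]; first exact: RacgRefl.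
by rewrite /= eqxx.
Qed.

Lemma rlen1 : rlen 1%g = 0%N.
Proof. exact: (comm_equiv_size (nf_congr (racg_repr_pi e [::]))). Qed.

Lemma gen2 v : (gen v * gen v = 1)%g.
Proof.
rewrite /gen; apply: etrans (racg_piM _ _ _) _.
exact/racg_piP/(RacgSquare _ [::] [::]).
Qed.

Lemma genC x y : e x y -> (gen x * gen y = gen y * gen x)%g.
Proof.
move=> exy; rewrite /gen; apply: etrans (racg_piM _ _ _) _.
apply: esym; apply: etrans (racg_piM _ _ _) _; apply: esym.
exact/racg_piP/(RacgComm [::] [::]).
Qed.

End NormalForms.

(** * A small resolution *)

Section Exponents.
Variable T : finType.
Implicit Types (f : {ffun T -> nat}) (x y v : T).

Definition incr f v : {ffun T -> nat} := [ffun x => (f x + (x == v))%N].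
Definition decr f v : {ffun T -> nat} := [ffun x => (f x - (x == v))%N].
Definition fsupp f := [set x | 0 < f x]%N.
Definition fdeg f := (\sum_x f x)%N.

(* The Koszul sign of moving past all the factors before [v]. *)
Definition ksign f v : int :=
  (-1) ^+ (\sum_(x | enum_rank x < enum_rank v) f x)%N.

Lemma in_fsupp f x : (x \in fsupp f) = (0 < f x)%N.
Proof. by rewrite inE. Qed.

Lemma incrK f v : decr (incr f v) v = f.
Proof. by apply/ffunP => x; rewrite !ffunE addnK. Qed.

Lemma decrK f v : (0 < f v)%N -> incr (decr f v) v = f.
Proof.
by move=> fv; apply/ffunP => x; rewrite !ffunE; case: eqP => [->|_]; rewrite ?subnK ?subn0 ?addn0.
Qed.

Lemma incr_decr f x v : x != v -> incr (decr f x) v = decr (incr f v) x.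
Proof.
move=> xv; apply/ffunP => y; rewrite !ffunE.
by case: (eqVneq y x) => [->|]; rewrite ?(negbTE xv) ?addn0 ?subn0.
Qed.

Lemma decrC f x y : decr (decr f x) y = decr (decr f y) x.
Proof. by apply/ffunP => z; rewrite !ffunE subnAC. Qed.

Lemma incr_same f v : incr f v v = (f v).+1.
Proof. by rewrite ffunE eqxx addn1. Qed.

Lemma incr_other f v x : x != v -> incr f v x = f x.
Proof. by rewrite ffunE => /negbTE ->; rewrite addn0. Qed.

Lemma decr_same f v : decr f v v = (f v).-1.
Proof. by rewrite ffunE eqxx subn1. Qed.

Lemma decr_other f v x : x != v -> decr f v x = f x.
Proof. by rewrite ffunE => /negbTE ->; rewrite subn0. Qed.

Lemma fsupp_incr f v : fsupp (incr f v) = v |: fsupp f.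
Proof. by apply/setP => x; rewrite !inE ffunE; case: eqP; rewrite ?addn0 // addn1. Qed.

Lemma fsupp_decr f v : fsupp (decr f v) = if (1 < f v)%N then fsupp f else fsupp f :\ v.
Proof.
apply/setP => x; rewrite inE ffunE; case: (eqVneq x v) => [->|xv].
  by case: ifP => fv; rewrite !inE ?eqxx ?subn_gt0 ?fv //= ltnW.
by rewrite subn0; case: ifP => _; rewrite !inE ?xv.
Qed.

Lemma fsupp0 f : fsupp f = set0 -> f = [ffun=> 0%N].
Proof. by move/setP=> f0; apply/ffunP => x; move: (f0 x); rewrite !inE ffunE; case: (f x). Qed.

Lemma fdeg_incr f v : fdeg (incr f v) = (fdeg f).+1.
Proof.
rewrite /fdeg -addn1; under eq_bigr do rewrite ffunE.
rewrite big_split /=; congr addn.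
by rewrite (bigD1 v) //= eqxx big1 // => x /negbTE ->.
Qed.

Lemma fdeg_decr f v : (0 < f v)%N -> fdeg f = (fdeg (decr f v)).+1.
Proof. by move=> fv; rewrite -(fdeg_incr _ v) decrK. Qed.

Lemma fdeg_eq0 f : (fdeg f == 0)%N = (fsupp f == set0).
Proof.
rewrite /fdeg sum_nat_eq0; apply/forallP/eqP => [f0|f0 x].
  by apply/setP => x; rewrite !inE; have := f0 x => /=; case: (f x).
by move/setP/(_ x): f0; rewrite !inE; case: (f x).
Qed.

Lemma ksign_incr f v x :
  ksign (incr f v) x = (-1) ^+ (enum_rank v < enum_rank x)%N * ksign f x.
Proof.
rewrite /ksign -exprD; congr (_ ^+ _); under eq_bigr do rewrite ffunE.
rewrite big_split /= addnC; congr addn.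
case: (boolP (enum_rank v < enum_rank x)%N) => vx; last first.
  by rewrite big1 // => y yx; case: eqP yx => // ->; rewrite (negbTE vx).
by rewrite (bigD1 v) //= eqxx big1 // => y /andP[_ /negbTE ->].
Qed.

Lemma ksign_incr_same f v : ksign (incr f v) v = ksign f v.
Proof. by rewrite ksign_incr ltnn mul1r. Qed.

Lemma ksign_decr_same f v : (0 < f v)%N -> ksign (decr f v) v = ksign f v.
Proof. by move=> fv; rewrite -[in RHS](decrK fv) ksign_incr_same. Qed.

Lemma ksignK f v : ksign f v * ksign f v = 1.
Proof. by rewrite /ksign -expr2 sqrr_sign. Qed.

Lemma sign_lt_anti x y : x != y ->
  (-1) ^+ (enum_rank x < enum_rank y)%N = - (-1) ^+ (enum_rank y < enum_rank x)%N :> int.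
Proof.
move=> xy; case: (ltngtP (enum_rank x) (enum_rank y)) => //.
by move/val_inj/enum_rank_inj/eqP; rewrite (negbTE xy).
Qed.

(** Exactly one of [x] and [y] precedes the other in the enumeration, so exchanging the two
    lowerings changes the sign once. Hence the differential squares to zero. *)
Lemma ksign_anti f x y : x != y -> (0 < f x)%N -> (0 < f y)%N ->
  ksign (decr f x) y * ksign f x = - (ksign (decr f y) x * ksign f y).
Proof.
move=> xy fx fy.
rewrite -{2}(decrK fy) ksign_incr -{4}(decrK fx) ksign_incr (sign_lt_anti xy).
by case: (enum_rank y < enum_rank x)%N; ring.
Qed.

(** Raising at [v] anticommutes with lowering at [x]; this cancels the off-diagonal terms in the
    contractions below. *)
Lemma ksign_exchange f x v : x != v -> (0 < f x)%N ->
  ksign (decr f x) v * ksign f x = - (ksign (incr f v) x * ksign f v).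
Proof.
move=> xv fx; rewrite ksign_incr -[in X in - (_ * X)](decrK fx) ksign_incr.
rewrite (sign_lt_anti xv); case: (enum_rank v < enum_rank x)%N; ring.
Qed.

Lemma ksignP f v : sign_spec (ksign f v).
Proof. exact: signP. Qed.

End Exponents.

(** * Longest elements of cosets and their descents *)

Section Candidates.
Variables (T : finType) (e : rel T).
Hypotheses (e_sym : symmetric e) (e_irr : irreflexive e).
Local Notation W := (racg e).
Local Notation gen := (gen e).
Implicit Types (w : W) (s : {set T}) (x y v : T).

Lemma is_simplexP s :
  reflect {in s &, forall x y, x != y -> e x y} (is_simplex e s).
Proof.
apply: (iffP forall_inP) => ss x => [y xs ys xy|xs].
  by have /forall_inP/(_ y ys)/implyP := ss x xs; apply.
by apply/forall_inP => y ys; apply/implyP; apply: ss.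
Qed.

(* In the coset [w <s>] let [u] be the longest element. Then [cand w s] is the
   set of right descents of [u], and [lev w s] is the length of [u]. *)
Definition cand w s :=
  [set v | (v \in s) || (rdesc w v && [forall x in s, e x v])].
Definition lev w s := (rlen w + #|[set x in s | ~~ rdesc w x]|)%N.

Lemma cand_mul w s x : x \in s -> is_simplex e s -> cand (w * gen x)%g s = cand w s.
Proof.
move=> xs ss; apply/setP => y; rewrite !inE.
case: (boolP (y \in s)) => //= ys; case: (boolP [forall _ in s, _]) => [|]; last by rewrite !andbF.
by move=> /forall_inP/(_ x xs) exy; rewrite rdesc_mul_adj // e_sym.
Qed.

(** Multiplying by [gen x] changes the length by one and the status of [x] as a descent in the
    compensating way; the other letters of [s] commute with [x] and keep their status. *)
Lemma lev_mul w s x : x \in s -> is_simplex e s -> lev (w * gen x)%g s = lev w s.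
Proof.
move=> xs /is_simplexP ss; rewrite /lev rlen_mul_gen //.
rewrite (cardsD1 x) [in RHS](cardsD1 x) !inE xs rdesc_mul_gen // negbK /=.
have -> : [set y in s | ~~ rdesc (w * gen x)%g y] :\ x = [set y in s | ~~ rdesc w y] :\ x.
  apply/setP => y; rewrite !inE; case: eqVneq => //= yx; case ys: (y \in s) => //=.
  by rewrite rdesc_mul_adj //; apply: ss.
have := @rdesc_rlen _ e w x; case: (rdesc w x) => [/(_ isT)|_] /=; last by rewrite addSnnS.
by rewrite addnA addn1 => /prednK ->.
Qed.

Lemma lev_drop w s x : x \in s ->
  lev w s = (~~ rdesc w x + lev w (s :\ x))%N.
Proof.
move=> xs; rewrite /lev (cardsD1 x) !inE xs /= addnCA; congr (_ + (_ + _))%N.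
by apply: eq_card => y; rewrite !inE andbA.
Qed.

(** As [x] is a descent of [w], the smaller coset has the same longest element: [x] leaves the
    clique but comes back as a descent adjacent to the rest. *)
Lemma cand_drop w s x : x \in s -> is_simplex e s -> rdesc w x ->
  cand w (s :\ x) = cand w s.
Proof.
move=> xs /is_simplexP ss wx; apply/setP => y; rewrite !inE.
case: (eqVneq y x) => [->|yx] /=.
  rewrite xs wx; apply/forall_inP => z; rewrite !inE => /andP[zx zs]; exact: ss.
case: (boolP (y \in s)) => //= ys; case wy: (rdesc w y) => //=.
have exy : e x y by apply: (rdesc_clique e_sym wx wy); rewrite eq_sym.
apply/forall_inP/forall_inP => sy z; last by rewrite inE => /andP[_ /sy].
by move=> zs; case: (eqVneq z x) => [->|zx] //; apply: sy; rewrite !inE zx.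
Qed.

Lemma simplex_sub s s' : s' \subset s -> is_simplex e s -> is_simplex e s'.
Proof.
move=> /subsetP ss' /is_simplexP ss; apply/is_simplexP => x y xs ys.
by apply: ss; apply: ss'.
Qed.

Lemma cand_simplex w s v : v \in cand w s -> is_simplex e s -> is_simplex e (v |: s).
Proof.
rewrite inE => /orP[vs|/andP[_ /forall_inP sv]] ss; first by rewrite (setUidPr _) ?sub1set.
apply/is_simplexP => x y; rewrite !inE => /orP[/eqP->|xs] /orP[/eqP->|ys].
- by rewrite eqxx.
- by rewrite e_sym sv.
- by rewrite sv.
- exact/(is_simplexP _ ss).
Qed.

Lemma lev_add w s v : rdesc w v -> lev w (v |: s) = lev w s.
Proof.
move=> wv; case: (boolP (v \in s)) => vs; first by rewrite (setUidPr _) ?sub1set.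
by rewrite (@lev_drop _ _ v) ?setU11 // wv setU1K.
Qed.

Lemma cand_adj w s x v : v \in cand w s -> x \in s -> is_simplex e s -> x != v -> e x v.
Proof.
move=> vC xs ss; apply: (is_simplexP _ (cand_simplex vC ss)); rewrite !inE ?eqxx //.
by rewrite xs orbT.
Qed.

(** Without candidates the longest element of the coset has no right descent, so it is trivial. *)
Lemma cand0 w s : cand w s = set0 -> s = set0 /\ w = 1%g.
Proof.
move=> c0; have s0 : s = set0.
  by apply/setP => x; move/setP/(_ x): c0; rewrite !inE; case: (x \in s).
split=> //; apply: (rdesc0 e_sym) => v; move/setP/(_ v): c0.
rewrite s0 !inE /=; case: (rdesc w v) => //= /negbT/forall_inPn[x].
by rewrite inE.
Qed.

End Candidates.

(** * The cells and their differential *)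

Section CoxeterComplex.
Variables (T : finType) (e : rel T).
Hypotheses (e_sym : symmetric e) (e_irr : irreflexive e).
Local Notation W := (racg e).
Local Notation gen := (gen e).
Local Notation cell := (W * {ffun T -> nat})%type.
Local Notation M := {freeg cell / int}.
Implicit Types (w : W) (f : {ffun T -> nat}) (p q : cell) (x y v : T) (z : M).

(* The cell [(w, f)] is [w] times the product over [v] of the degree [f v] generators of
   the periodic resolutions of the groups of order two generated by the [gen v]. *)
Definition wterm v p : M :=
  if (0 < p.2 v)%N then
    (<< ((p.1 * gen v)%g, decr p.2 v) >> +
     << (p.1, decr p.2 v) >> *~ (-1) ^+ p.2 v) *~ ksign p.2 v
  else 0.

Definition wdiff : M -> M := fglift (fun p => \sum_v wterm v p).
HB.instance Definition _ := GRing.Additive.on wdiff.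

Lemma wdiffU p : wdiff << p >> = \sum_v wterm v p.
Proof. exact: fgliftU. Qed.

Lemma wdiffE z : wdiff z = \sum_v fglift (wterm v) z.
Proof.
elim/freeg_ind: z => [|p|y z IHy IHz].
- by rewrite raddf0 big1 // => v _; rewrite raddf0.
- by rewrite wdiffU; apply: eq_bigr => v _; rewrite fgliftU.
- by rewrite raddfB /= IHy IHz -sumrB; apply: eq_bigr => v _; rewrite raddfB.
Qed.

Definition clique_cell p := is_simplex e (fsupp p.2).

(** This is [(gen v - 1) (gen v + 1) = 0], as [gen v] is an involution. *)
Lemma wterm2_same v p : fglift (wterm v) (wterm v p) = 0.
Proof.
rewrite {2}/wterm; case: ifP => fv; last by rewrite raddf0.
rewrite raddfMz raddfD /= raddfMz /= !fgliftU /wterm /= decr_same.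
case: ifP => fv'; last by rewrite mul0rz addr0 mul0rz.
case: (p.2 v) fv fv' => // n _ /= _; rewrite -mulgA gen2 mulg1 exprS.
by freeg_ring; case: (signP n); ring.
Qed.

Lemma wterm_out x y p : p.2 y = 0%N -> fglift (wterm y) (wterm x p) = 0.
Proof.
move=> fy; rewrite [wterm x p]/wterm; case: ifP => _; last by rewrite raddf0.
rewrite raddfMz raddfD /= raddfMz /= !fgliftU /wterm /=.
by rewrite ffunE fy sub0n ltnn mul0rz addr0 mul0rz.
Qed.

(** Vertices of a clique have commuting generators, so only the signs matter, and [ksign_anti]
    compares them. *)
Lemma wterm2_anti x y p : clique_cell p -> x != y ->
  fglift (wterm y) (wterm x p) = - fglift (wterm x) (wterm y p).
Proof.
case: p => w f /is_simplexP ss xy.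
case: (posnP (f x)) => [fx|fx].
  by rewrite [wterm x _]/wterm fx raddf0 (@wterm_out _ x (w, f)) // oppr0.
case: (posnP (f y)) => [fy|fy].
  by rewrite [wterm y _ in RHS]/wterm fy raddf0 oppr0 (@wterm_out _ y (w, f)).
rewrite [wterm x _]/wterm [wterm y _ in RHS]/wterm /= fx fy.
have exy : e x y by apply: ss; rewrite ?inE.
rewrite !raddfMz !raddfD /= !raddfMz /= !fgliftU /wterm /=.
rewrite !decr_other // 1?eq_sym // fx fy decrC -!mulgA (genC exy).
have E := ksign_anti xy fx fy; freeg_ring.
by move: E; do 4!case: ksignP; move=> // _; ring.
Qed.

Lemma wdiff2U p : clique_cell p -> wdiff (wdiff << p >>) = 0.
Proof.
move=> gp; rewrite wdiffU wdiffE.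
have -> : \sum_v fglift (wterm v) (\sum_x wterm x p) =
    \sum_v \sum_x fglift (wterm v) (wterm x p).
  by apply: eq_bigr => v _; rewrite raddf_sum.
(* Exchanging the two summations shows that the double sum equals its own negative. *)
apply: freeg_torsion_free; rewrite -sumrN [LHS]exchange_big /=.
apply: eq_bigr => x _; rewrite -sumrN; apply: eq_bigr => y _.
case: (eqVneq x y) => [->|xy]; first by rewrite wterm2_same oppr0.
exact: wterm2_anti.
Qed.

Lemma wdiff2 z : supported clique_cell z -> wdiff (wdiff z) = 0.
Proof.
move: z; apply: freeg_ind_in => [|p|y z IHy IHz]; first by rewrite !raddf0.
  exact: wdiff2U.
by rewrite !raddfB /= IHy IHz subrr.
Qed.

End CoxeterComplex.

Arguments clique_cell {T e} p.

(** * Exactness by the level filtration *)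

Section Contraction.
Variables (T : finType) (e : rel T).
Hypotheses (e_sym : symmetric e) (e_irr : irreflexive e).
Local Notation W := (racg e).
Local Notation gen := (gen e).
Local Notation cell := (W * {ffun T -> nat})%type.
Local Notation M := {freeg cell / int}.
Implicit Types (w : W) (f : {ffun T -> nat}) (p q : cell) (x y v : T) (z : M).

Definition ccand p := cand p.1 (fsupp p.2).
Definition clev p := lev p.1 (fsupp p.2).

(* On the graded piece of level [clev p], this contracts the factor at one fixed right
   descent of the longest element of the coset. *)
Definition whom : M -> M := fglift (fun p =>
  if [pick v in ccand p] is Some v then
    if rdesc p.1 v then << ((p.1 * gen v)%g, incr p.2 v) >> *~ ksign p.2 v else 0
  else 0).
HB.instance Definition _ := GRing.Additive.on whom.

(** Works modulo the cells of level below [L]; with [L] the level of a cell, this passes to its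
    graded piece. *)
Definition trunc L : M -> M := fglift (fun q => if (clev q < L)%N then 0 else << q >>).
HB.instance Definition _ L := GRing.Additive.on (trunc L).

Lemma truncU L q : trunc L << q >> = << q >> *~ (L <= clev q)%N.
Proof. by rewrite /trunc fgliftU (leqNgt L); case: (clev q < L)%N; rewrite ?mulr0z ?mulr1z. Qed.

Lemma trunc_supported L z : trunc L z = 0 -> supported (fun q => clev q < L)%N z.
Proof.
move=> z0 q; rewrite mem_dom; apply: contraNT; rewrite -leqNgt => Lq.
suff <- : coeff q (trunc L z) = coeff q z by rewrite z0 coeff0.
elim/freeg_ind: z {z0} => [|p|y z IHy IHz]; first by rewrite !raddf0.
  rewrite truncU coeffMz coeffU.
  by case: (eqVneq p q) => [->|_]; rewrite ?Lq ?mulr1 ?mulr0 ?mul0r.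
by rewrite !raddfB /= IHy IHz.
Qed.

(** Since [v] is a descent of [w], enlarging the support by [v] keeps the level, and [w] and
    [w * gen v] lie in the same enlarged coset. *)
Lemma clev_incr w f v : clique_cell (w, f) -> v \in cand w (fsupp f) -> rdesc w v ->
  clev ((w * gen v)%g, incr f v) = clev (w, f).
Proof.
move=> gf vC wv; rewrite /clev /= fsupp_incr lev_mul ?setU11 ?lev_add //.
exact: cand_simplex vC gf.
Qed.

Lemma clique_cell_incr w f v : clique_cell (w, f) -> v \in cand w (fsupp f) ->
  clique_cell ((w * gen v)%g, incr f v).
Proof. by move=> gf vC; rewrite /clique_cell /= fsupp_incr; apply: cand_simplex vC gf. Qed.

Lemma clique_cell_decr w w' f v : clique_cell (w, f) -> clique_cell (w', decr f v).
Proof.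
rewrite /clique_cell /= fsupp_decr; case: ifP => // _; apply: simplex_sub; exact: subD1set.
Qed.

Lemma trunc_whom L z : supported clique_cell z -> trunc L (whom z) = whom (trunc L z).
Proof.
move: z; apply: freeg_ind_in => [|[w f] gp|y z IHy IHz]; first by rewrite !raddf0.
  rewrite truncU raddfMz /= /whom fgliftU /ccand /=.
  case: pickP => [v vC|_]; last by rewrite raddf0 mul0rz.
  case: ifP => wv; last by rewrite raddf0 mul0rz.
  by rewrite raddfMz /= truncU clev_incr // mulrzAC.
by rewrite !raddfB /= IHy IHz.
Qed.

(* Whether lowering [f] at [x] keeps the level of [(w, f)]. *)
Definition survives w f x := rdesc w x || (1 < f x)%N.

(** The support changes only when the value 1 at [x] drops to 0, and then the level falls exactly
    when [x] is not a descent of [w]. *)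
Lemma clev_decr w f x : (0 < f x)%N ->
  (clev (w, f) <= clev (w, decr f x))%N = survives w f x.
Proof.
move=> fx; rewrite /clev /survives /= fsupp_decr; case: ifP => [_|_]; first by rewrite leqnn orbT.
by rewrite (@lev_drop _ _ _ _ x) ?inE // orbF; case: rdesc; rewrite ?leqnn ?ltnn.
Qed.

Lemma cand_decr w f x : clique_cell (w, f) -> (0 < f x)%N -> survives w f x ->
  cand w (fsupp (decr f x)) = cand w (fsupp f).
Proof.
rewrite /survives fsupp_decr => gf fx; case: ifP => // _; rewrite orbF => wx.
by apply: cand_drop => //; rewrite inE.
Qed.

Lemma trunc_wterm w f x : clique_cell (w, f) -> (0 < f x)%N ->
  trunc (clev (w, f)) (wterm x (w, f)) =
  (<< ((w * gen x)%g, decr f x) >> *~ survives (w * gen x)%g f x +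
   << (w, decr f x) >> *~ survives w f x *~ (-1) ^+ f x) *~ ksign f x.
Proof.
move=> gf fx; rewrite /wterm /= fx raddfMz raddfD /= raddfMz /= !truncU clev_decr //.
by rewrite -(clev_decr (w * gen x)%g fx) /clev /= [lev (_ * _)%g (fsupp f)]lev_mul ?inE.
Qed.

(** A surviving term has the same candidates, so [pick] returns the same [v] and the contraction
    acts in the same factor. *)
Lemma whom_decr w f x v : clique_cell (w, f) -> (0 < f x)%N ->
  [pick u in cand w (fsupp f)] = Some v ->
  whom << (w, decr f x) >> *~ survives w f x =
  (if rdesc w v then << ((w * gen v)%g, incr (decr f x) v) >> *~ ksign (decr f x) v else 0)
   *~ survives w f x.
Proof.
move=> gf fx pv; case: (boolP (survives w f x)) => // sx.
by rewrite /whom fgliftU /ccand /= cand_decr // pv.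
Qed.

Lemma whom_trunc_wterm w f x v : clique_cell (w, f) -> (0 < f x)%N ->
  [pick u in cand w (fsupp f)] = Some v ->
  whom (trunc (clev (w, f)) (wterm x (w, f))) =
  ((if rdesc (w * gen x)%g v then
      << ((w * gen x * gen v)%g, incr (decr f x) v) >> *~ ksign (decr f x) v else 0)
     *~ survives (w * gen x)%g f x +
   (if rdesc w v then << ((w * gen v)%g, incr (decr f x) v) >> *~ ksign (decr f x) v else 0)
     *~ survives w f x *~ (-1) ^+ f x) *~ ksign f x.
Proof.
move=> gf fx pv; have gf' : clique_cell ((w * gen x)%g, f) by [].
rewrite trunc_wterm // raddfMz raddfD !raddfMz /=.
by rewrite (whom_decr gf fx pv) (@whom_decr _ f x v gf' fx) // cand_mul // inE.
Qed.

Lemma wterm_eq0 x p : p.2 x = 0%N -> wterm x p = 0.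
Proof. by rewrite /wterm => ->. Qed.

(** Here the homotopy raises [f] at [v]. The terms at other vertices cancel by [ksign_exchange]; at
    [v], the term that multiplies by [gen v] returns the cell. *)
Lemma contraction_desc w f v : clique_cell (w, f) -> [pick u in cand w (fsupp f)] = Some v ->
  rdesc w v ->
  trunc (clev (w, f)) (wdiff (whom << (w, f) >>)) +
  whom (trunc (clev (w, f)) (wdiff << (w, f) >>)) = << (w, f) >>.
Proof.
move=> gf pv wv; have vC : v \in cand w (fsupp f) by case: pickP pv => // u uC [<-].
have gh := clique_cell_incr gf vC; have Lh := clev_incr gf vC wv.
rewrite {1}/whom fgliftU /ccand /= pv wv !raddfMz /= !wdiffU !raddf_sum /=.
rewrite -{1}Lh mulrz_suml -big_split /= (bigD1 v) //= [X in _ + X]big1 => [|x xv]; last first.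
  case: (posnP (f x)) => [fx|fx].
    by rewrite !wterm_eq0 //= ?incr_other // !raddf0 mul0rz addr0.
  have exv : e x v by apply: (cand_adj e_sym vC _ gf xv); rewrite inE.
  have evx : e v x by rewrite e_sym.
  rewrite (whom_trunc_wterm gf fx pv) trunc_wterm ?incr_other // rdesc_mul_adj 1?e_sym // wv.
  have -> : survives (w * gen v * gen x)%g (incr f v) x = survives (w * gen x)%g f x.
    rewrite /survives incr_other // -mulgA (genC evx) mulgA.
    by rewrite [LHS](congr1 (orb^~ _) (rdesc_mul_adj _ _ _ exv)).
  have -> : survives (w * gen v)%g (incr f v) x = survives w f x.
    by rewrite /survives incr_other // rdesc_mul_adj.
  rewrite -(incr_decr _ xv) -mulgA (genC evx) mulgA.
  have E := ksign_exchange xv fx; freeg_ring.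
  by move: E; do 4!case: ksignP; move=> // _; ring.
rewrite addr0 trunc_wterm ?incr_same // -mulgA gen2 mulg1 incrK ksign_incr_same.
rewrite /survives wv rdesc_mul_gen // wv incr_same ltnS /= mulr1z.
(* For [f v = 0] the second term at [v] takes [v] out of the support and falls in level. Otherwise
   it survives, and the term at [v] of the other composite cancels it. *)
case: (posnP (f v)) => [fv|fv].
  rewrite wterm_eq0 // !raddf0 addr0 mul0rz addr0 -mulrzA.
  by rewrite ksignK mulr1z.
rewrite (whom_trunc_wterm gf fv pv) rdesc_mul_gen // wv /= mul0rz add0r.
rewrite decrK // ksign_decr_same // /survives wv /= !mulr1z exprS.
by freeg_ring; case: ksignP; ring.
Qed.

(** Here [v] lies in the support. The homotopy kills the cell and every term of its differential but
    the one that multiplies by [gen v] and lowers at [v], which it sends back to the cell. *)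
Lemma contraction_asc w f v : clique_cell (w, f) -> [pick u in cand w (fsupp f)] = Some v ->
  ~~ rdesc w v ->
  whom << (w, f) >> = 0 /\
  whom (trunc (clev (w, f)) (wdiff << (w, f) >>)) = << (w, f) >>.
Proof.
move=> gf pv wv; have vC : v \in cand w (fsupp f) by case: pickP pv => // u uC [<-].
have fv : (0 < f v)%N by move: vC; rewrite inE (negbTE wv) orbF inE.
split; first by rewrite /whom fgliftU /ccand /= pv (negbTE wv).
rewrite wdiffU !raddf_sum /= (bigD1 v) //= [X in _ + X]big1 => [|x xv]; last first.
  case: (posnP (f x)) => [fx|fx]; first by rewrite wterm_eq0 // !raddf0.
  have exv : e x v by apply: (cand_adj e_sym vC _ gf xv); rewrite inE.
  rewrite (whom_trunc_wterm gf fx pv) rdesc_mul_adj 1?e_sym // (negbTE wv).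
  by rewrite !mul0rz addr0 mul0rz.
rewrite (whom_trunc_wterm gf fv pv) rdesc_mul_gen // wv /survives rdesc_mul_gen // wv.
rewrite (negbTE wv) /= !mul0rz !addr0 -mulgA gen2 mulg1 decrK // ksign_decr_same //.
by rewrite mulr1z -mulrzA ksignK mulr1z.
Qed.

Definition base_cell : cell := (1%g, [ffun=> 0%N]).

(** The augmentation, with values written as multiples of [base_cell]. *)
Definition wbase : M -> M :=
  fglift (fun p => if fsupp p.2 == set0 then << base_cell >> else 0).
HB.instance Definition _ := GRing.Additive.on wbase.

Lemma wbaseU p : wbase << p >> = if fsupp p.2 == set0 then << base_cell >> else 0.
Proof. exact: fgliftU. Qed.

Lemma wbase_wdiff z : wbase (wdiff z) = 0.
Proof.
elim/freeg_ind: z => [|[w f]|y z IHy IHz]; first by rewrite !raddf0.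
  rewrite wdiffU raddf_sum big1 //= => v _; rewrite /wterm /=.
  case: ifP => fv; last by rewrite raddf0.
  rewrite raddfMz raddfD /= raddfMz /= !wbaseU /=; case: eqP => [f0|_]; last first.
    by rewrite mul0rz addr0 mul0rz.
  (* In degree one the two terms have opposite signs and the same augmentation. *)
  suff -> : f v = 1%N by rewrite expr1 mulrN1z subrr mul0rz.
  move/setP/(_ v): f0; rewrite inE decr_same inE.
  by case: (f v) fv => // [[]].
by rewrite !raddfB /= IHy IHz subrr.
Qed.

Definition cell_deg n p := clique_cell p /\ fdeg p.2 = n.

Lemma wdiff_cell_deg n z :
  supported (cell_deg n.+1) z -> supported (cell_deg n) (wdiff z).
Proof.
apply: supported_fglift => -[w f] [gf df]; apply: supported_sum => v _.
rewrite /wterm /=; case: ifP => fv; last exact: supported0.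
have dd : fdeg (decr f v) = n by move: df; rewrite (fdeg_decr fv) => -[].
apply: supportedMz; apply: supportedD; last apply: supportedMz.
  by apply: supportedU; split=> //; apply: clique_cell_decr gf.
by apply: supportedU; split=> //; apply: clique_cell_decr gf.
Qed.

Lemma wdiff_cell_deg0 p : fdeg p.2 = 0%N -> wdiff << p >> = 0.
Proof.
move/eqP; rewrite fdeg_eq0 => /eqP p0; rewrite wdiffU big1 // => v _.
by move/setP/(_ v): p0; rewrite !inE /wterm => ->.
Qed.

Lemma whom_cell_deg n z :
  supported (cell_deg n) z -> supported (cell_deg n.+1) (whom z).
Proof.
apply: supported_fglift => -[w f] [gf df]; rewrite /ccand /=.
case: pickP => [v vC|_]; last exact: supported0.
case: ifP => _; last exact: supported0.
by apply: supportedMz; apply: supportedU; split; [apply: clique_cell_incr | rewrite fdeg_incr df].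
Qed.

Lemma whom_wdiff_cell_deg n p :
  cell_deg n p -> supported (cell_deg n) (whom (wdiff << p >>)).
Proof.
case: n => [[_ p0]|n pn]; first by rewrite wdiff_cell_deg0 // raddf0; apply: supported0.
by apply: whom_cell_deg; apply: wdiff_cell_deg; apply: supportedU.
Qed.

Lemma wbase_cell_deg n z : supported (cell_deg n) z -> supported (cell_deg n) (wbase z).
Proof.
apply: supported_fglift => -[w f] [gf df] /=.
rewrite -fdeg_eq0; case: eqP => [f0|_]; last exact: supported0.
apply: supportedU; split; last first.
  by rewrite -df f0; apply/eqP; rewrite fdeg_eq0; apply/eqP/setP => x; rewrite !inE ffunE.
by apply/is_simplexP => x y; rewrite !inE ffunE.
Qed.

Lemma clev_base : clev base_cell = 0%N.
Proof.
rewrite /clev /lev rlen1 //= eq_card0 // => x; rewrite !inE ffunE //.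
Qed.

(** On the graded pieces [whom] contracts everything but [base_cell], so the error of the homotopy
    formula has strictly lower level. *)
Lemma contraction_lower n p : cell_deg n p ->
  supported (fun q => clev q < clev p)%N
    (<< p >> - wbase << p >> - (wdiff (whom << p >>) + whom (wdiff << p >>))).
Proof.
case: p => w f [gf df]; apply: trunc_supported.
have tw : trunc (clev (w, f)) (whom (wdiff << (w, f) >>)) =
    whom (trunc (clev (w, f)) (wdiff << (w, f) >>)).
  case: n df => [|n] df; first by rewrite wdiff_cell_deg0 // !raddf0.
  apply: trunc_whom; apply: (@supported_mono _ (cell_deg n)); first by move=> q [].
  by apply: wdiff_cell_deg; apply: supportedU.
rewrite !raddfB /= raddfD /= tw truncU leqnn mulr1z.
case pE: [pick u in cand w (fsupp f)] => [v|].
  (* If the support is empty, the candidate is a descent of [w], so the cell lies above [base_cell],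
     which has level 0. *)
  have -> : trunc (clev (w, f)) (wbase << (w, f) >>) = 0.
    rewrite wbaseU /=; case: eqP => [f0|_]; last exact: raddf0.
    rewrite truncU leqNgt; case: pickP pE => // u uC _.
    have wu : rdesc w u by move: uC; rewrite inE f0 in_set0 => /andP[].
    rewrite clev_base.
    by rewrite /clev /= /lev (leq_trans (rdesc_rlen wu)) ?leq_addr // mulr0z.
  rewrite subr0; case: (boolP (rdesc w v)) => wv.
    by rewrite (contraction_desc gf pE wv) subrr.
  by have [-> ->] := contraction_asc gf pE wv; rewrite !raddf0 add0r subrr.
(* Without candidates the cell is [base_cell], fixed by [wbase] and killed by the homotopy and the
   differential. *)
have [f0 w1] : fsupp f = set0 /\ w = 1%g.
  by apply: (cand0 e_sym); apply/setP => u; case: pickP pE => // /(_ u) -> _; rewrite inE.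
rewrite wbaseU /= f0 eqxx w1 (fsupp0 f0) truncU leqnn mulr1z subrr.
rewrite wdiff_cell_deg0; last by apply/eqP; rewrite fdeg_eq0 -(fsupp0 f0) f0.
rewrite /whom fgliftU /ccand /=.
case: pickP => [u|_]; last by rewrite !raddf0 addr0 subrr.
by rewrite -(fsupp0 f0) -w1; case: pickP pE => // /(_ u) ->.
Qed.

(** Induction on the bound for the level: subtracting [wdiff (whom z)] from the cycle [z] leaves a
    cycle of lower level. *)
Lemma wexact n k z : supported (fun p => cell_deg n p /\ clev p < k)%N z ->
  wdiff z = 0 -> wbase z = 0 ->
  exists2 c, supported (cell_deg n.+1) c & wdiff c = z.
Proof.
elim: k z => [|k IHk] z Az dz bz.
  exists 0; first exact: supported0.
  rewrite raddf0; move: Az; move: {dz bz} z; apply: freeg_ind_in => // [q []//|y z <- <-].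
  by rewrite subr0.
have low (y : M) : supported (fun p => cell_deg n p /\ clev p < k.+1)%N y ->
    supported (fun p => cell_deg n p /\ clev p < k)%N
      (y - wbase y - (wdiff (whom y) + whom (wdiff y))).
  move: y; apply: freeg_ind_in => [|p [np pk]|x y Hx Hy].
  - by rewrite !raddf0 !addr0 subr0; apply: supported0.
  - move=> q qd; split; last first.
      exact: leq_trans (contraction_lower np qd) _.
    move: q qd; have pn := supportedU np.
    apply: supportedB; first by apply: supportedB => //; apply: wbase_cell_deg.
    apply: supportedD; first by apply: wdiff_cell_deg; apply: whom_cell_deg.
    exact: whom_wdiff_cell_deg.
  - have := supportedB Hx Hy; congr supported.
    rewrite !raddfB /= !opprD !opprK; freeg_ring; ring.
have := low z Az; rewrite bz dz !raddf0 !addr0 => Az'.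
have hz : supported (cell_deg n.+1) (whom z).
  by apply: whom_cell_deg; apply: supported_mono Az => p [].
case: (IHk _ Az').
- rewrite raddfB /= dz wdiff2 ?subrr //.
  by apply: supported_mono hz => p [].
- by rewrite raddfB /= bz wbase_wdiff subrr.
- move=> c cn dc; exists (c + whom z); first exact: supportedD.
  by rewrite raddfD /= dc subrK.
Qed.

End Contraction.

(** * The cells as a free resolution *)

Section CoxeterResolution.
Variables (T : finType) (e : rel T).
Hypotheses (e_sym : symmetric e) (e_irr : irreflexive e).
Local Notation W := (racg e).
Local Notation cell := (W * {ffun T -> nat})%type.
Local Notation M := {freeg cell / int}.
Implicit Types (w g : W) (f : {ffun T -> nat}) (z : M).

Definition mexp n := {f : {ffun T -> nat} | is_simplex e (fsupp f) && (fdeg f == n)}.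

Local Notation N n := {freeg (W * mexp n)%type / int}.

Lemma mexp_cell_deg n w (b : mexp n) : cell_deg n (w, val b).
Proof. by case/andP: (valP b) => ? /eqP ?. Qed.

Definition mincl n : N n -> M := fglift (fun p : W * mexp n => << (p.1, val p.2) >> : M).
HB.instance Definition _ n := GRing.Additive.on (@mincl n).

(** Inverts [mincl] on the span of the cells in [cell_deg n]; all other cells go to the default
    0. *)
Definition mproj n : M -> N n := fglift (fun q : cell =>
  if insub q.2 is Some b then << (q.1, b) >> else 0 : N n).
HB.instance Definition _ n := GRing.Additive.on (@mproj n).

Lemma minclU n w (b : mexp n) : mincl << (w, b) >> = << (w, val b) >>.
Proof. exact: fgliftU. Qed.

Lemma minclK n : cancel (@mincl n) (@mproj n).
Proof.
elim/freeg_ind=> [|[w b]|x y IHx IHy]; first by rewrite !raddf0.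
  by rewrite minclU /mproj fgliftU /= valK.
by rewrite !raddfB /= IHx IHy.
Qed.

Lemma mincl_cell_deg n (y : N n) : supported (cell_deg n) (mincl y).
Proof.
apply: (@supported_fglift _ _ xpredT) => // -[w b] _.
apply: supportedU; exact: mexp_cell_deg.
Qed.

Lemma mprojK n z : supported (cell_deg n) z -> mincl (mproj n z) = z.
Proof.
move: z; apply: freeg_ind_in => [|[w f] [/= gf df]|x y IHx IHy]; first by rewrite !raddf0.
  rewrite /mproj fgliftU /=; case: insubP => [b _ <-|]; first exact: minclU.
  by move: gf; rewrite /clique_cell /= => ->; rewrite df eqxx.
by rewrite !raddfB /= IHx IHy.
Qed.

Lemma wdiff_gact g z : wdiff (gact g z) = gact g (wdiff z).
Proof.
elim/freeg_ind: z => [|[w f]|x y IHx IHy]; first by rewrite !raddf0.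
  rewrite gactU !wdiffU raddf_sum; apply: eq_bigr => v _; rewrite /wterm /=.
  case: ifP => _; last by rewrite raddf0.
  by rewrite raddfMz raddfD /= raddfMz /= !gactU /= mulgA.
by rewrite !raddfB /= IHx IHy.
Qed.

Lemma mproj_gact n g z : mproj n (gact g z) = gact g (mproj n z).
Proof.
elim/freeg_ind: z => [|[w f]|x y IHx IHy]; first by rewrite !raddf0.
  rewrite gactU /mproj !fgliftU /=; case: insubP => [b _ _|_]; last by rewrite raddf0.
  by rewrite gactU.
by rewrite !raddfB /= IHx IHy.
Qed.

Definition mdiff n (b : mexp n.+1) : N n := mproj n (wdiff << (1%g : W, val b) >>).

Lemma gext_mdiff n (y : N n.+1) : gext (@mdiff n) y = mproj n (wdiff (mincl y)).
Proof.
elim/freeg_ind: y => [|[w b]|x y IHx IHy]; first by rewrite !raddf0.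
  by rewrite gextU minclU -mproj_gact -wdiff_gact gactU /= mulg1.
by rewrite !raddfB /= IHx IHy.
Qed.

Lemma mincl_mdiff n (y : N n.+1) : mincl (gext (@mdiff n) y) = wdiff (mincl y).
Proof. by rewrite gext_mdiff mprojK //; apply/wdiff_cell_deg/mincl_cell_deg. Qed.

Lemma wbase_mincl0 (y : N 0) : wbase (mincl y) = << base_cell e >> *~ deg y.
Proof.
elim/freeg_ind: y => [|[w b]|x y IHx IHy]; first by rewrite !raddf0.
  have [_ /= db] := mexp_cell_deg w b.
  by rewrite minclU wbaseU /= -fdeg_eq0 db degU.
by rewrite !raddfB /= IHx IHy.
Qed.

Lemma wbase_minclS n (y : N n.+1) : wbase (mincl y) = 0.
Proof.
elim/freeg_ind: y => [|[w b]|x y IHx IHy]; first by rewrite !raddf0.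
  have [_ /= db] := mexp_cell_deg w b.
  by rewrite minclU wbaseU /= -fdeg_eq0 db.
by rewrite !raddfB /= IHx IHy subrr.
Qed.

Lemma wdiff_mincl0 (y : N 0) : wdiff (mincl y) = 0.
Proof.
elim/freeg_ind: y => [|[w b]|x y IHx IHy]; first by rewrite !raddf0.
  have [_ /= db] := mexp_cell_deg w b.
  by rewrite minclU wdiff_cell_deg0.
by rewrite !raddfB /= IHx IHy subrr.
Qed.

(** In degree 0 [wbase] records the augmentation as the coefficient of [base_cell], so [wbase_wdiff]
    applies. *)
Lemma mdiff_deg (b : mexp 1) : deg (mdiff b) = 0.
Proof.
have := wbase_mincl0 (mdiff b); rewrite -[mdiff b]gext1U mincl_mdiff wbase_wdiff.
by move/(congr1 (coeff (base_cell e))); rewrite coeff0 coeffMz coeffU eqxx !mul1r.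
Qed.

Lemma mdiff2 n (b : mexp n.+2) : gext (@mdiff n) (mdiff b) = 0.
Proof.
rewrite gext_mdiff -[mdiff b]gext1U mincl_mdiff wdiff2 ?raddf0 //.
by have := @mincl_cell_deg n.+2 << (1%g, b) >>; apply: supported_mono => p [].
Qed.

Lemma mdiff_exact n (y : N n) : wdiff (mincl y) = 0 -> wbase (mincl y) = 0 ->
  exists c, gext (@mdiff n) c = y.
Proof.
move=> dy by0; have [k yk] : exists k, supported (fun p => clev p < k)%N (mincl y).
  (* A chain has finite support, so its levels are bounded. *)
  exists (\max_(p <- dom (mincl y)) clev p).+1 => p py.
  by rewrite ltnS (big_rem p) //= leq_maxl.
have [//|c cn dc] := wexact e_sym e_irr (n := n) (k := k) _ dy by0.
  by move=> p py; split; [apply: (mincl_cell_deg py) | apply: yk].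
by exists (mproj n.+1 c); rewrite gext_mdiff mprojK // dc minclK.
Qed.

Lemma mdiff_exact0 (y : N 0) : deg y = 0 -> exists c, gext (@mdiff 0) c = y.
Proof.
by move=> y0; apply: mdiff_exact; rewrite ?wdiff_mincl0 // wbase_mincl0 y0 mulr0z.
Qed.

Lemma mdiff_exactS n (y : N n.+1) : gext (@mdiff n) y = 0 ->
  exists c, gext (@mdiff n.+1) c = y.
Proof.
by move=> y0; apply: mdiff_exact; rewrite ?wbase_minclS // -mincl_mdiff y0 raddf0.
Qed.

Lemma mexp0_subproof :
  is_simplex e (fsupp ([ffun=> 0%N] : {ffun T -> nat})) &&
  (fdeg ([ffun=> 0%N] : {ffun T -> nat}) == 0)%N.
Proof.
rewrite fdeg_eq0; have -> : fsupp ([ffun=> 0%N] : {ffun T -> nat}) = set0.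
  by apply/setP => x; rewrite !inE ffunE.
by rewrite eqxx andbT; apply/is_simplexP => x y; rewrite inE.
Qed.

Definition mexp0 : mexp 0 :=
  exist (fun f : {ffun T -> nat} => is_simplex e (fsupp f) && (fdeg f == 0)%N) _
    mexp0_subproof.

Definition coxeter_resolution : resolution W :=
  @Resolution W (fun n => mexp n : choiceType) mexp0 mdiff
    mdiff_deg mdiff2 mdiff_exact0 mdiff_exactS.

End CoxeterResolution.

(** * The coinvariants of the small resolution *)

Section Coinvariants.
Variable T : finType.
Local Notation S := {freeg {ffun T -> nat} / int}.
Implicit Types (f : {ffun T -> nat}) (x v : T) (z : S).

(* The differential on coinvariants is twice [cdiff]: its coefficient [1 + (-1) ^ f x] is
   0 or 2. *)
Definition cterm x f : S :=
  if (0 < f x)%N && ~~ odd (f x) then << decr f x >> *~ ksign f x else 0.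

Definition cdiff : S -> S := fglift (fun f => \sum_x cterm x f).
HB.instance Definition _ := GRing.Additive.on cdiff.

Lemma cdiffU f : cdiff << f >> = \sum_x cterm x f.
Proof. exact: fgliftU. Qed.

(** The [f] with odd value at the chosen vertex of the support; the coefficients at these determine
    a cycle of positive degree. *)
Definition leading f := if [pick v in fsupp f] is Some v then odd (f v) else false.

(** Contracts [cdiff] away from the zero multi-index. As [cdiff] preserves supports, the chosen
    vertex is the same throughout. *)
Definition chom : S -> S := fglift (fun f =>
  if [pick v in fsupp f] is Some v then
    if odd (f v) then << incr f v >> *~ ksign f v else 0
  else 0).
HB.instance Definition _ := GRing.Additive.on chom.

Lemma fsupp_decr_even f x : (0 < f x)%N && ~~ odd (f x) -> fsupp (decr f x) = fsupp f.
Proof. by rewrite fsupp_decr; case: (f x) => [|[|n]]. Qed.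

Lemma fsupp_incr_in f v : v \in fsupp f -> fsupp (incr f v) = fsupp f.
Proof. by move=> vf; rewrite fsupp_incr (setUidPr _) ?sub1set. Qed.

Lemma chom_notleading f : ~~ leading f -> chom << f >> = 0.
Proof.
by rewrite /leading /chom fgliftU; case: pickP => // v _ /negbTE ->.
Qed.

Lemma cdiff_chom_leading f v : [pick v in fsupp f] = Some v -> odd (f v) ->
  cdiff (chom << f >>) =
  << f >> + \sum_(x | x != v) cterm x (incr f v) *~ ksign f v.
Proof.
move=> pv ov; rewrite /chom fgliftU pv ov raddfMz /= cdiffU mulrz_suml (bigD1 v) //=.
congr (_ + _); rewrite /cterm incr_same /= ov incrK ksign_incr_same -mulrzA.
by rewrite ksignK.
Qed.

(** For an odd value at the chosen vertex, raising and lowering there returns [f] and the other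
    terms cancel. For an even value [chom] kills [f], as well as all terms of [cdiff] but the one
    lowered at that vertex, which it raises back to [f]. *)
Lemma cdiff_chomU f : fsupp f != set0 ->
  cdiff (chom << f >>) + chom (cdiff << f >>) = << f >>.
Proof.
case pv: [pick v in fsupp f] => [v|]; last first.
  by case/set0Pn=> x xf; case: pickP pv => // /(_ x); rewrite xf.
move=> _; have vf : v \in fsupp f by case: pickP pv => // u uf [<-].
have fv : (0 < f v)%N by rewrite -in_fsupp.
case: (boolP (odd (f v))) => ov.
  rewrite (cdiff_chom_leading pv ov) cdiffU raddf_sum /= [X in _ + X](bigD1 v) //=.
  rewrite {2}/cterm ov andbF raddf0 add0r -addrA -big_split big1 ?addr0 //= => x xv.
  rewrite /cterm incr_other //; case: ifP => fx; last by rewrite raddf0 mul0rz addr0.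
  rewrite raddfMz /= /chom fgliftU fsupp_decr_even // pv decr_other 1?eq_sym // ov.
  case/andP: fx => fx _; rewrite incr_decr //.
  have E := ksign_exchange xv fx; freeg_ring.
  by move: E; do 4!case: ksignP; move=> // _; ring.
have -> : chom << f >> = 0 by apply: chom_notleading; rewrite /leading pv.
rewrite raddf0 add0r cdiffU raddf_sum /= (bigD1 v) //= [X in _ + X]big1 ?addr0 => [|x xv].
  rewrite /cterm fv ov raddfMz /= /chom fgliftU fsupp_decr_even ?fv // pv decr_same.
  have -> : odd (f v).-1 by move: ov fv; case: (f v) => //= n; rewrite negbK.
  by rewrite decrK // ksign_decr_same // -mulrzA ksignK.
rewrite /cterm; case: ifP => fx; last by rewrite raddf0.
by rewrite raddfMz /= /chom fgliftU fsupp_decr_even // pv decr_other 1?eq_sym // (negbTE ov) mul0rz.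
Qed.

Lemma cdiff_chom z : supported (fun f => fsupp f != set0) z ->
  cdiff (chom z) + chom (cdiff z) = z.
Proof.
move: z; apply: freeg_ind_in => [|f|y z IHy IHz]; first by rewrite !raddf0 addr0.
  exact: cdiff_chomU.
by rewrite -[in RHS]IHy -[in RHS]IHz !raddfB /= opprD addrACA.
Qed.

(** Every term other than [f] keeps the raised, hence even, value at the chosen vertex and so is not
    leading. *)
Lemma coeff_cdiff_chom f f' : leading f -> leading f' ->
  coeff f' (cdiff (chom << f >>)) = (f == f')%:R.
Proof.
rewrite {1}/leading; case pv: [pick v in fsupp f] => [v|] // ov lf'.
have vf : v \in fsupp f by case: pickP pv => // u uf [<-].
rewrite (cdiff_chom_leading pv ov) coeffD coeffU mul1r raddf_sum big1 ?addr0 //= => x xv.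
rewrite /cterm; case: ifP => [fx|_]; last by rewrite mul0rz coeff0.
rewrite !coeffMz coeffU; case: eqP lf' => [<-|_]; last by rewrite !mulr0 !mul0r.
rewrite /leading fsupp_decr_even // fsupp_incr_in // pv decr_other 1?eq_sym //.
by rewrite incr_same /= ov.
Qed.

End Coinvariants.

Arguments leading {T} f.

(** * Cycles and boundaries of the coinvariants *)

Section CoxeterCoinvariants.
Variables (T : finType) (e : rel T).
Hypotheses (e_sym : symmetric e) (e_irr : irreflexive e).
Local Notation S := {freeg {ffun T -> nat} / int}.
Local Notation N n := {freeg (mexp e n) / int}.
Local Notation cd n := (coext (@mdiff T e n)).
Implicit Types (f : {ffun T -> nat}) (x v : T) (z : S).

Definition valid n f := is_simplex e (fsupp f) /\ fdeg f = n.

Lemma mexp_valid n (b : mexp e n) : valid n (val b).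
Proof. by case/andP: (valP b) => ? /eqP ?. Qed.

Lemma chom_valid n z : supported (valid n) z -> supported (valid n.+1) (chom z).
Proof.
apply: supported_fglift => f [sf df]; case: pickP => [v vf|_]; last exact: supported0.
case: ifP => _; last exact: supported0.
by apply: supportedMz; apply: supportedU; rewrite /valid fdeg_incr df fsupp_incr_in.
Qed.

Lemma cdiff_valid n z : supported (valid n.+1) z -> supported (valid n) (cdiff z).
Proof.
apply: supported_fglift => f [sf df]; apply: supported_sum => x _.
rewrite /cterm; case: ifP => fx; last exact: supported0.
apply: supportedMz; apply: supportedU; rewrite /valid fsupp_decr_even //.
by case/andP: fx => fx _; move: df; rewrite (fdeg_decr fx) => -[].
Qed.

Definition sincl n : N n -> S := fglift (fun b => << val b >> : S).
HB.instance Definition _ n := GRing.Additive.on (@sincl n).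

Definition sproj n : S -> N n :=
  fglift (fun f => if insub f is Some b then << b >> else 0 : N n).
HB.instance Definition _ n := GRing.Additive.on (@sproj n).

Lemma sinclU n (b : mexp e n) : sincl << b >> = << val b >>.
Proof. exact: fgliftU. Qed.

Lemma sinclK n : cancel (@sincl n) (@sproj n).
Proof.
elim/freeg_ind=> [|b|x y IHx IHy]; first by rewrite !raddf0.
  by rewrite sinclU /sproj fgliftU valK.
by rewrite !raddfB /= IHx IHy.
Qed.

Lemma sincl_valid n (y : N n) : supported (valid n) (sincl y).
Proof.
apply: (@supported_fglift _ _ xpredT) => // b _.
by apply: supportedU; apply: mexp_valid.
Qed.

Lemma sprojK n z : supported (valid n) z -> sincl (sproj n z) = z.
Proof.
move: z; apply: freeg_ind_in => [|f [sf df]|x y IHx IHy]; first by rewrite !raddf0.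
  rewrite /sproj fgliftU; case: insubP => [b _ <-|]; first exact: sinclU.
  by rewrite sf df eqxx.
by rewrite !raddfB /= IHx IHy.
Qed.

Lemma coeff_sincl n (b : mexp e n) (y : N n) : coeff (val b) (sincl y) = coeff b y.
Proof.
elim/freeg_ind: y => [|b'|x y IHx IHy]; first by rewrite !raddf0.
  by rewrite sinclU !coeffU (inj_eq val_inj).
by rewrite !raddfB /= IHx IHy.
Qed.

Lemma sincl_coinv n (u : {freeg (racg e * mexp e n)%type / int}) :
  sincl (coinv u) = coinv (mincl u).
Proof.
elim/freeg_ind: u => [|[w b]|x y IHx IHy]; first by rewrite !raddf0.
  by rewrite minclU !coinvU sinclU.
by rewrite !raddfB /= IHx IHy.
Qed.

Lemma coinv_wdiff (w : racg e) f : coinv (wdiff << (w, f) >>) = cdiff << f >> *~ 2.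
Proof.
rewrite wdiffU cdiffU raddf_sum mulrz_suml; apply: eq_bigr => x _ /=.
rewrite /wterm /cterm /=; case: ifP => fx /=; last by rewrite raddf0 mul0rz.
rewrite raddfMz raddfD /= raddfMz /= !coinvU /= -signr_odd.
by case: (odd (f x)) => /=; freeg_ring; ring.
Qed.

Lemma sincl_coext n (y : N n.+1) : sincl (cd n y) = cdiff (sincl y) *~ 2.
Proof.
elim/freeg_ind: y => [|b|x y IHx IHy]; first by rewrite !raddf0 mul0rz.
  rewrite coextU sincl_coinv sinclU -(coinv_wdiff 1%g) -[mdiff b]gext1U mincl_mdiff.
  by rewrite minclU.
by rewrite !raddfB /= IHx IHy mulrzBl.
Qed.

Lemma coext_mdiffK n (y : N n.+2) : cd n (cd n.+1 y) = 0.
Proof.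
elim/freeg_ind: y => [|b|x y IHx IHy]; first by rewrite !raddf0.
  by rewrite coextU -coinv_gext mdiff2 // raddf0.
by rewrite !raddfB /= IHx IHy subrr.
Qed.

(** A cycle satisfies [y = cdiff (chom y)], and [chom] sees only the leading coefficients. If these
    are even, [chom y] is twice a chain [c], so [y] is [2 cdiff c], the boundary of [c]. *)
Lemma coinv_cycle_even_boundary n (y : N n.+1) : cd n y = 0 ->
  (forall b : mexp e n.+1, leading (val b) -> (2 %| coeff b y)%Z) ->
  exists c, cd n.+1 c = y.
Proof.
move=> dy y2; have dz : cdiff (sincl y) = 0.
  by apply: (@freeg_mulz_eq0 _ _ 2) => //; rewrite -sincl_coext dy raddf0.
have [f|c cE] := @fglift_even _ _ _ (sincl y) _ : exists c, chom (sincl y) = c *~ 2.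
  case: (boolP (leading f)) => lf; last first.
    by left; have := chom_notleading lf; rewrite /chom fgliftU.
  right; case: (boolP (f \in dom (sincl y))) => [fy|/coeff_outdom -> //].
  have [sf df] := sincl_valid fy.
  have bf : is_simplex e (fsupp f) && (fdeg f == n.+1) by rewrite sf df eqxx.
  by have := y2 (Sub f bf) lf; rewrite -coeff_sincl.
have vc : supported (valid n.+2) c.
  by apply: (@supportedMz_inv _ _ _ 2) => //; rewrite -cE; apply: chom_valid; apply: sincl_valid.
exists (sproj n.+2 c); apply: (can_inj (@sinclK _)).
rewrite sincl_coext sprojK // -raddfMz /= -cE.
have := @cdiff_chom _ (sincl y); rewrite dz raddf0 addr0; apply => f fy.
by have [_ df] := sincl_valid fy; rewrite -fdeg_eq0 df.
Qed.

(** The cycle is [cdiff (chom b)]. Together these cycles form a dual family for the leading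
    coefficients. *)
Lemma coinv_cycle_leading n (b : mexp e n.+1) : leading (val b) ->
  exists2 y : N n.+1, cd n y = 0 &
    forall b' : mexp e n.+1, leading (val b') -> coeff b' y = (b == b')%:R.
Proof.
move=> lb; have vh : supported (valid n.+2) (chom << val b >>).
  by apply: chom_valid; apply: supportedU; apply: mexp_valid.
have vd := cdiff_valid vh.
exists (sproj n.+1 (cdiff (chom << val b >>))); last first.
  by move=> b' lb'; rewrite -coeff_sincl sprojK // coeff_cdiff_chom.
(* Twice this element is a boundary, so twice its differential vanishes, and the group has no
   torsion. *)
apply: (@freeg_mulz_eq0 _ _ 2) => //.
rewrite -raddfMz -(coext_mdiffK (sproj n.+2 (chom << val b >>))) /=.
congr (cd n _); apply: (can_inj (@sinclK _)).
by rewrite sincl_coext raddfMz /= !sprojK.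
Qed.

End CoxeterCoinvariants.

(** * Counting *)

Section Compositions.
Variable T : finType.
Implicit Types (f : {ffun T -> nat}) (s : {set T}) (x v : T).

(** Lowering at the chosen vertex either keeps the support or removes that vertex, hence the two
    lists. *)
Fixpoint comps n s : seq {ffun T -> nat} :=
  if n is m.+1 then
    if [pick x in s] is Some x then
      [seq incr f x | f <- comps m s] ++ [seq incr f x | f <- comps m (s :\ x)]
    else [::]
  else if s == set0 then [:: [ffun=> 0%N]] else [::].

Lemma compsS n s : comps n.+1 s =
  if [pick x in s] is Some x then
    [seq incr f x | f <- comps n s] ++ [seq incr f x | f <- comps n (s :\ x)]
  else [::].
Proof. by []. Qed.

Lemma incr_inj x : injective (fun f => incr f x).
Proof. by move=> f g fg; rewrite -(incrK f x) fg incrK. Qed.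

Lemma mem_comps n s f : (f \in comps n s) = (fsupp f == s) && (fdeg f == n).
Proof.
elim: n s f => [|n IHn] s f /=.
  rewrite fdeg_eq0; case: (eqVneq s set0) => [->|s0]; last first.
    by rewrite in_nil; case: eqP => // ->; rewrite (negbTE s0).
  rewrite andbb inE; apply/eqP/eqP => [->|/fsupp0 //].
  by apply/setP => x; rewrite !inE ffunE.
case: pickP => [x xs|s0]; last first.
  have -> : s = set0 by apply/setP => x; rewrite s0 inE.
  by rewrite in_nil; case: eqP => // /eqP; rewrite -fdeg_eq0 => /eqP ->.
rewrite mem_cat; apply/orP/andP => [[] /mapP[g]|[/eqP fs /eqP df]].
- by rewrite IHn => /andP[/eqP gs /eqP dg] ->;
    rewrite fdeg_incr dg fsupp_incr gs (setUidPr _) ?sub1set.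
- by rewrite IHn => /andP[/eqP gs /eqP dg] ->; rewrite fdeg_incr dg fsupp_incr gs setD1K.
have fx : (0 < f x)%N by rewrite -in_fsupp fs.
have dg : fdeg (decr f x) = n by move: df; rewrite (fdeg_decr fx) => -[].
have := fsupp_decr f x; rewrite fs; case: ifP => _ sg; [left|right];
  by apply/mapP; exists (decr f x); rewrite ?decrK // IHn sg dg !eqxx.
Qed.

Lemma uniq_comps n s : uniq (comps n s).
Proof.
elim: n s => [|n IHn] s /=; first by case: ifP.
case: pickP => // x xs; rewrite cat_uniq !map_inj_uniq ?IHn ?andbT //=; do ?exact: incr_inj.
apply/hasPn => f /mapP[g]; rewrite mem_comps => /andP[/eqP gs _] ->.
apply/negP => /mapP[h]; rewrite mem_comps => /andP[/eqP hs _] /incr_inj gh.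
by move: xs; rewrite -hs -gh gs !inE eqxx.
Qed.

(** Compositions of [n.+1] into [k.+1] positive parts; the recursion is Pascal's rule. *)
Lemma size_comps n s k : #|s| = k.+1 -> size (comps n.+1 s) = 'C(n, k).
Proof.
elim: n s k => [|n IHn] s k sk; rewrite compsS; case: pickP => [x xs|s0];
  try by move: sk; rewrite eq_card0.
all: have sxk : #|s :\ x| = k by move: sk; rewrite (cardsD1 x) xs => -[].
all: rewrite size_cat !size_map.
- rewrite /= -!cards_eq0 sk sxk bin0n; by case: k {sk sxk}.
- case: k => [|k] in sk sxk *; last by rewrite (IHn _ _ sk) (IHn _ _ sxk).
  (* For [k = 0] the second list is empty: no multi-index of positive degree has empty support. *)
  rewrite (IHn _ _ sk) bin0; have -> : s :\ x = set0 by apply/eqP; rewrite -cards_eq0 sxk.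
  by rewrite compsS; case: pickP => // y; rewrite inE.
Qed.

Definition leading_comps n s := [seq f <- comps n s | leading f].

(** Raising at the chosen vertex is a bijection from the leading multi-indices of degree [n] onto
    the others of degree [n.+1]. *)
Lemma size_leading_comps_rec n s : s != set0 ->
  (size (leading_comps n.+1 s) + size (leading_comps n s) = size (comps n.+1 s))%N.
Proof.
case pv: [pick v in s] => [v|]; last first.
  by case/set0Pn=> x xs; case: pickP pv => // /(_ x); rewrite xs.
move=> _; have vs : v \in s by case: pickP pv => // u us [<-].
rewrite -(count_predC leading (comps n.+1 s)) !size_filter; congr addn.
rewrite -!size_filter -(size_map (fun f => incr f v)); apply: perm_size.
apply: uniq_perm.
- by rewrite map_inj_uniq ?filter_uniq ?uniq_comps //; apply: incr_inj.
- by rewrite filter_uniq ?uniq_comps.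
move=> f; rewrite mem_filter mem_comps; apply/mapP/idP => [[g]|].
  rewrite mem_filter mem_comps => /and3P[lg /eqP gs /eqP dg] ->.
  have vg : v \in fsupp g by rewrite gs.
  rewrite /= fdeg_incr dg fsupp_incr_in // gs !eqxx !andbT.
  by move: lg; rewrite /leading fsupp_incr_in // gs pv incr_same /= => ->.
case/and3P=> /= lf /eqP fs /eqP df; have fv : (0 < f v)%N by rewrite -in_fsupp fs.
have ev : ~~ odd (f v) by move: lf; rewrite /leading fs pv.
have gs : fsupp (decr f v) = s by rewrite fsupp_decr_even ?fv.
exists (decr f v); last by rewrite decrK.
rewrite mem_filter mem_comps gs eqxx; apply/andP; split.
  by rewrite /leading gs pv decr_same; move: ev fv; case: (f v) => //= m; rewrite negbK.
by move: df; rewrite (fdeg_decr fv) => -[->] /=.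
Qed.

(** Increasing [n] flips the sign of every old summand, so only the new one at [j = n] remains. *)
Lemma rhoS n k : rho n.+1 k + rho n k = 'C(n, k)%:Z.
Proof.
rewrite /rho; case: (leqP k n) => kn; last first.
  by rewrite !big_geq ?bin_small // ltnW.
rewrite big_nat_recr //= subnn expr0 mul1r addrAC -big_split /=.
rewrite big_nat_cond big1 ?add0r // => j; rewrite andbT => /andP[kj jn].
have -> : (n - j = (n.-1 - j).+1)%N by lia.
by rewrite exprS mulN1r mulNr addNr.
Qed.

Lemma size_leading_comps n s k : #|s| = k.+1 ->
  (size (leading_comps n s))%:Z = rho n k.
Proof.
move=> sk; have s0 : s != set0 by rewrite -cards_eq0 sk.
elim: n => [|n IHn].
  by rewrite /leading_comps /= (negbTE s0) /rho big_geq.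
have := size_leading_comps_rec n s0; rewrite (size_comps _ sk) => E.
by have := rhoS n k; rewrite -E -IHn PoszD => /addIr <-.
Qed.

(** By [size_leading_comps] the value of [rho] is a cardinality, hence not negative. The empty
    simplex has no chosen vertex and so no leading multi-index. *)
Lemma multiplicityE (e : rel T) n (s : simplex e) :
  multiplicity n s = size (leading_comps n (val s)).
Proof.
rewrite /multiplicity /Defs.dim; case sk: #|val s| => [|k].
  rewrite /leading_comps; case E: [seq f <- _ | leading f] => [|f l] //.
  have : f \in [seq f <- comps n (val s) | leading f] by rewrite E mem_head.
  rewrite mem_filter mem_comps => /and3P[lf /eqP fs _].
  move: lf; rewrite /leading fs; case: pickP => // x; move/eqP: sk.
  by rewrite cards_eq0 => /eqP ->; rewrite inE.
have -> : k.+1%:Z - 1 = k by lia.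
by rewrite -(size_leading_comps _ sk).
Qed.

End Compositions.

(** * The summands as leading multi-indices *)

Section LeadingIndex.
Variables (T : finType) (e : rel T) (n : nat).
Local Notation J := {s : simplex e & 'I_(multiplicity n s)}.
Implicit Types (u : J).

Definition leading_nth u : {ffun T -> nat} :=
  nth [ffun=> 0%N] (leading_comps n (val (tag u))) (tagged u).

Lemma leading_nthP u :
  [/\ leading (leading_nth u), fsupp (leading_nth u) = val (tag u)
    & fdeg (leading_nth u) = n].
Proof.
have : leading_nth u \in leading_comps n (val (tag u)).
  by rewrite mem_nth // -multiplicityE.
by rewrite mem_filter mem_comps => /and3P[? /eqP ? /eqP ?].
Qed.

Lemma leading_nth_mexp u :
  is_simplex e (fsupp (leading_nth u)) && (fdeg (leading_nth u) == n).
Proof. by have [_ -> ->] := leading_nthP u; rewrite eqxx andbT (valP (tag u)). Qed.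

(** A bijection from the index set of the direct sum onto the leading multi-indices of degree [n],
    as shown below. *)
Definition leading_index u : mexp e n := Sub (leading_nth u) (leading_nth_mexp u).

Lemma leading_leading_index u : leading (val (leading_index u)).
Proof. by have [] := leading_nthP u. Qed.

Lemma leading_index_inj : injective leading_index.
Proof.
move=> u u' /(congr1 val) /= uu'.
have [_ su _] := leading_nthP u; have [_ su' _] := leading_nthP u'.
have : tag u = tag u' by apply: val_inj; rewrite -su -su' uu'.
case: u u' uu' {su su'} => [s i] [s' j] /= ij ss'; case: s' / ss' j ij => j.
rewrite /leading_nth /= => /eqP; rewrite nth_uniq ?filter_uniq ?uniq_comps //.
- by move=> /eqP/val_inj ->.
- by rewrite -multiplicityE.
- by rewrite -multiplicityE.
Qed.

Lemma leading_index_surj (b : mexp e n) : leading (val b) -> exists u, leading_index u = b.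
Proof.
case: b => f vf /= lf; case/andP: (vf) => sf df.
have fL : f \in leading_comps n (fsupp f) by rewrite mem_filter lf mem_comps eqxx df.
pose s : simplex e := Sub (fsupp f) sf.
have jL : (index f (leading_comps n (fsupp f)) < multiplicity n s)%N.
  by rewrite multiplicityE index_mem.
exists (Tagged (fun s => 'I_(multiplicity n s)) (Ordinal jL)); apply: val_inj; exact: nth_index.
Qed.

End LeadingIndex.

(** * The isomorphism *)

(** The first isomorphism theorem; the inverse picks preimages by choice. *)
Lemma quot_isomorphic (Z A : zmodType) (I : zmodClosed Z) (f : {additive Z -> A}) :
  (forall z, (z \in I) = (f z == 0)) -> (forall a, exists z, f z = a) ->
  isomorphic (Quotient.quot I) A.
Proof.
move=> fI f_surj; pose g (q : Quotient.quot I) := f (repr q).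
have gE z : g (\pi_(Quotient.quot I)%qT z) = f z.
  apply/eqP; rewrite -subr_eq0 -raddfB -fI Quotient.idealrBE.
  by apply/eqP; rewrite reprK.
have g_additive : zmod_morphism g.
  move=> x y; rewrite -[x]reprK -[y]reprK -raddfB !gE; exact: raddfB.
pose G := GRing.isZmodMorphism.Build _ _ g g_additive.
pose ga : {additive Quotient.quot I -> A} := HB.pack g G.
exists ga; exists (fun a => \pi_(Quotient.quot I)%qT (sval (cid (f_surj a)))).
  move=> q; rewrite -[RHS]reprK; apply/eqP; rewrite -Quotient.idealrBE fI raddfB subr_eq0.
  exact/eqP/(svalP (cid (f_surj (g q)))).
by move=> a; rewrite [LHS]gE (svalP (cid (f_surj a))).
Qed.

Lemma intr_Z2_eq0 (c : int) : (c%:~R == 0 :> 'Z_2) = (2 %| c)%Z.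
Proof. by rewrite (dvdz_pcharf (pchar_Fp (isT : prime 2))). Qed.

(* The direct sum over pairs (s, j) is finite, hence equal to the group of
   functions from the finite set of pairs to C_2. *)
Theorem theorem7p1 (T : finType) (e : rel T)
    (e_sym : symmetric e) (e_irr : irreflexive e) (n : nat) (n_ge1 : (1 <= n)%N) :
  isomorphic (group_homology (racg e) n)
    {ffun {s : simplex e & 'I_(multiplicity n s)} -> 'Z_2}.
Proof.
case: n n_ge1 => // m _.
pose R := coxeter_resolution e_sym e_irr.
have [F [F_cycle F_bound F_surj]] := coinv_homology_equiv (bar_resolution (racg e)) R m.
pose ix := @leading_index T e m.+1.
(* Carry a bar cycle to the small complex and reduce its leading coefficients modulo 2. *)
pose theta (z : cycles (racg e) m.+1) : {ffun {s : simplex e & 'I_(multiplicity m.+1 s)} -> 'Z_2} :=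
  [ffun u => (coeff (ix u) (F (val z)))%:~R].
have theta_additive : zmod_morphism theta.
  move=> y z; apply/ffunP => u.
  by rewrite !ffunE -rmorphB -coeffB -(raddfB F).
pose H := GRing.isZmodMorphism.Build _ _ theta theta_additive.
pose th : {additive cycles (racg e) m.+1 -> _} := HB.pack theta H.
have cycleE (z : bar_chain (racg e) m.+1) :
    z \in @bar_cycle (racg e) m.+1 <-> coinv_cycle (R := bar_resolution (racg e)) z.
  rewrite inE /coinv_cycle -[bar_diff z]coext_bar_rdiff.
  by split=> [/eqP|->].
apply: (quot_isomorphic (f := th)) => [z|a].
  have cz : coinv_cycle (R := bar_resolution (racg e)) (val z) by apply/cycleE/(valP z).
  rewrite inE; apply/asboolP/eqP => [[c cE]|z0].
    (* Boundaries of the small complex have even coefficients, as its differential is twice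
       [cdiff]. *)
    have [|d dE] := (F_bound _ cz).2; first by exists c; rewrite -cE; apply: coext_bar_rdiff.
    apply/ffunP => u; rewrite !ffunE -dE; apply/eqP.
    rewrite intr_Z2_eq0 -coeff_sincl sincl_coext // coeffMz.
    exact: dvdz_mull.
  (* Conversely, even leading coefficients make the image a boundary, and [F] reflects
     boundaries. *)
  have [|c cE] := (F_bound _ cz).1.
    apply: (coinv_cycle_even_boundary (F_cycle _ cz)) => b lb.
    have [u <-] := leading_index_surj lb.
    by rewrite -intr_Z2_eq0; move/ffunP/(_ u): z0; rewrite !ffunE => ->.
  by exists c; rewrite -[LHS]coext_bar_rdiff.
have dual (u : {s : simplex e & 'I_(multiplicity m.+1 s)}) :=
  coinv_cycle_leading (leading_leading_index u).
(* The dual cycles, weighted by representatives of the values of [a], realize the prescribed leading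
   coefficients. *)
pose y := \sum_u s2val (cid2 (dual u)) *~ (a u : nat).
have [|z cz [c cE]] := F_surj y.
  rewrite /coinv_cycle /y raddf_sum big1 // => u _.
  by rewrite raddfMz /= (s2valP (cid2 (dual u))) mul0rz.
exists (Sub z (iffRL (cycleE z) cz)); apply/ffunP => u; rewrite ffunE SubK.
(* [F z] agrees with [y] only up to a boundary, which vanishes modulo 2. *)
have -> : F z = y + coext (@mdiff T e m.+1) c by rewrite cE addrC subrK.
rewrite coeffD rmorphD /=.
have -> : (coeff (ix u) (coext (@mdiff T e m.+1) c))%:~R = 0 :> 'Z_2.
  apply/eqP; rewrite intr_Z2_eq0 -coeff_sincl sincl_coext // coeffMz.
  exact: dvdz_mull.
rewrite addr0 /y raddf_sum (bigD1 u) //= big1 => [|v vu]; last first.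
  rewrite coeffMz (s2valP' (cid2 (dual v))) ?leading_leading_index //.
  by rewrite (inj_eq (@leading_index_inj _ _ _)) (negbTE vu) mul0r.
rewrite coeffMz (s2valP' (cid2 (dual u))) ?leading_leading_index // eqxx mul1r addr0.
exact: natr_Zp.
Qed.
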